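(* Let $A$ be the infinitesimal generator of a $C_0$-semigroup $(T(t))_{t\ge0}$ on a Banach space $X$. If $\lim_{t\to\infty}\frac{1}{t^n}\|T(t)\|=0$ for some $n\in\mathbb{N}$, then the following assertions are equivalent: (1) $A$ is quasi-Fredholm; (2) $A$ is Drazin invertible; (3) $A$ is B-Fredholm.
   Context: $X$ is a complex Banach space. For a linear operator $S$ with domain $D(S)$, powers $S^m$ have their natural domains, with $S^0=I$; $N(S)$ and $R(S)$ denote kernel and range, and $R^\infty(S)=\bigcap_{m\ge0}R(S^m)$. $S$ is semi-regular if $R(S)$ is closed and $N(S)\subseteq R^\infty(S)$. $S$ is Fredholm if $N(S)$ is finite-dimensional and $R(S)$ is closed and of finite codimension in the target space. For a closed operator $S$ on $X$ and an integer $m\ge0$ with $R(S^m)$ closed, let $S_m$ be the restriction of $S$ to $R(S^m)$, viewed as an operator in the Banach space $R(S^m)$ with domain $R(S^m)\cap D(S)$ and values in $R(S^m)$. Then $S$ is quasi-Fredholm (respectively B-Fredholm) if there exists an integer $m\ge0$ such that $R(S^m)$ is closed and $S_m$ is semi-regular (respectively Fredholm). $S$ is Drazin invertible if its ascent $a(S)=\inf\{m\in\mathbb{N}:N(S^m)=N(S^{m+1})\}$ and its descent $d(S)=\inf\{m\in\mathbb{N}:R(S^m)=R(S^{m+1})\}$ are both finite ($\mathbb{N}=\{0,1,2,\dots\}$, $\inf\emptyset=\infty$). *)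

(* Defs.v *)
From Stdlib Require Import Reals.
From Coquelicot Require Import Coquelicot.

Open Scope R_scope.

Definition is_subspace {X : CompleteNormedModule C_AbsRing} (V : X -> Prop) : Prop :=
  V zero
  /\ (forall x y, V x -> V y -> V (plus x y))
  /\ (forall (k : C) x, V x -> V (scal k x)).

(* The span of [e 1, ..., e n]; it is {0} when [n = 0]. *)
Definition span {X : CompleteNormedModule C_AbsRing} (n : nat) (e : nat -> X) (x : X)
    : Prop :=
  exists c : nat -> C, x = sum_n_m (fun i => scal (c i) (e i)) 1 n.

Definition finite_dimensional {X : CompleteNormedModule C_AbsRing} (V : X -> Prop)
    : Prop :=
  exists (n : nat) (e : nat -> X),
    (forall i, (1 <= i <= n)%nat -> V (e i))
    /\ (forall x, V x -> span n e x).

Definition finite_codimension_in {X : CompleteNormedModule C_AbsRing}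
    (E V : X -> Prop) : Prop :=
  exists (n : nat) (e : nat -> X),
    (forall i, (1 <= i <= n)%nat -> E (e i))
    /\ (forall x, E x -> exists v, V v /\ span n e (minus x v)).

(* [closed] for the topology induced on the subset [E]. *)
Definition closed_in {X : CompleteNormedModule C_AbsRing} (E V : X -> Prop) : Prop :=
  forall x, E x -> ~ within E (locally x) (fun y => ~ V y) -> V x.

(* A not necessarily everywhere defined linear operator acting in a linear
   subspace [carrier] of [X].  It is given by its graph: [graph S x y] means
   that [x] is in the domain of [S] and [S x = y].  An operator on [X] itself
   has [carrier = fun _ => True]; other carriers are used for the restrictions
   S_m, which act in the range of S^m. *)
Record linear_operator (X : CompleteNormedModule C_AbsRing) := LinearOperator {
  carrier : X -> Prop;
  graph : X -> X -> Prop;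
  carrier_subspace : is_subspace carrier;
  graph_carrier : forall x y, graph x y -> carrier x /\ carrier y;
  graph_functional : forall x y z, graph x y -> graph x z -> y = z;
  graph_zero : graph zero zero;
  graph_plus : forall x y x' y',
    graph x y -> graph x' y' -> graph (plus x x') (plus y y');
  graph_scal : forall (k : C) x y, graph x y -> graph (scal k x) (scal k y)
}.

Arguments carrier {X} S _ : rename.
Arguments graph {X} S _ _ : rename.
Arguments carrier_subspace {X} S : rename.
Arguments graph_carrier {X} S {x y} _ : rename.
Arguments graph_functional {X} S {x y z} _ _ : rename.
Arguments graph_zero {X} S : rename.
Arguments graph_plus {X} S {x y x' y'} _ _ : rename.
Arguments graph_scal {X} S k {x y} _ : rename.

(* Graph of S^m on its natural domain; S^0 is the identity of the carrier. *)
Fixpoint power_graph {X : CompleteNormedModule C_AbsRing} (S : linear_operator X)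
    (m : nat) (x y : X) : Prop :=
  match m with
  | O => carrier S x /\ y = x
  | Datatypes.S k => exists z, power_graph S k x z /\ graph S z y
  end.

Section Power.
Context {X : CompleteNormedModule C_AbsRing}.
Implicit Type S : linear_operator X.

Lemma power_graph_carrier S m x y :
  power_graph S m x y -> carrier S x /\ carrier S y.
Proof.
revert y; induction m as [|m IH]; simpl; intros y.
- intros [H ->]; auto.
- intros (z & Hz & Hy); split.
  + apply (IH _ Hz).
  + apply (graph_carrier S Hy).
Qed.

Lemma power_graph_functional S m x y z :
  power_graph S m x y -> power_graph S m x z -> y = z.
Proof.
revert y z; induction m as [|m IH]; simpl; intros y z.
- intros [_ ->] [_ ->]; reflexivity.
- intros (u & Hu & Hy) (v & Hv & Hz).
  rewrite <- (IH _ _ Hu Hv) in Hz.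
  exact (graph_functional S Hy Hz).
Qed.

Lemma power_graph_zero S m : power_graph S m zero zero.
Proof.
induction m as [|m IH]; simpl.
- split; [apply (carrier_subspace S) | reflexivity].
- exists zero; split; [exact IH | apply graph_zero].
Qed.

Lemma power_graph_plus S m x y x' y' :
  power_graph S m x y -> power_graph S m x' y' ->
  power_graph S m (plus x x') (plus y y').
Proof.
revert y y'; induction m as [|m IH]; simpl; intros y y'.
- intros [H ->] [H' ->]; split; [now apply (carrier_subspace S) | reflexivity].
- intros (z & Hz & Hy) (z' & Hz' & Hy').
  exists (plus z z'); split; [now apply IH | now apply graph_plus].
Qed.

Lemma power_graph_scal S m (k : C) x y :
  power_graph S m x y -> power_graph S m (scal k x) (scal k y).
Proof.
revert y; induction m as [|m IH]; simpl; intros y.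
- intros [H ->]; split; [now apply (carrier_subspace S) | reflexivity].
- intros (z & Hz & Hy).
  exists (scal k z); split; [now apply IH | now apply graph_scal].
Qed.

End Power.

Definition power {X : CompleteNormedModule C_AbsRing} (S : linear_operator X) (m : nat)
    : linear_operator X :=
  {| carrier := carrier S;
     graph := power_graph S m;
     carrier_subspace := carrier_subspace S;
     graph_carrier := power_graph_carrier S m;
     graph_functional := power_graph_functional S m;
     graph_zero := power_graph_zero S m;
     graph_plus := power_graph_plus S m;
     graph_scal := power_graph_scal S m |}.

Definition kernel {X : CompleteNormedModule C_AbsRing} (S : linear_operator X) (x : X)
    : Prop :=
  graph S x zero.

Definition range {X : CompleteNormedModule C_AbsRing} (S : linear_operator X) (y : X)
    : Prop :=
  exists x, graph S x y.

Definition hyperrange {X : CompleteNormedModule C_AbsRing} (S : linear_operator X)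
    (y : X) : Prop :=
  forall m : nat, range (power S m) y.

Section Restriction.
Context {X : CompleteNormedModule C_AbsRing}.
Context (S : linear_operator X) (m : nat).

Let E := range (power S m).
Let G x y := E x /\ graph S x y.

Lemma range_power_subspace : is_subspace E.
Proof.
repeat split.
- exists zero; apply power_graph_zero.
- intros x y [u Hu] [v Hv]; exists (plus u v); now apply power_graph_plus.
- intros k x [u Hu]; exists (scal k u); now apply power_graph_scal.
Qed.

Lemma restr_graph_carrier x y : G x y -> E x /\ E y.
Proof.
intros [[u Hu] Hxy]; split; [now exists u |].
assert (H : power_graph S (Datatypes.S m) u y) by (now exists x).
clear Hu Hxy x; unfold E, range; simpl.
revert y H; induction m as [|k IH]; intros y (z & Hz & Hy).
- exists y; split; [apply (graph_carrier S Hy) | reflexivity].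
- destruct (IH z Hz) as [w Hw].
  exists w; now exists z.
Qed.

Lemma restr_graph_functional x y z : G x y -> G x z -> y = z.
Proof. intros [_ H] [_ H']; exact (graph_functional S H H'). Qed.

Lemma restr_graph_zero : G zero zero.
Proof. split; [apply range_power_subspace | apply graph_zero]. Qed.

Lemma restr_graph_plus x y x' y' :
  G x y -> G x' y' -> G (plus x x') (plus y y').
Proof.
intros [H1 H2] [H1' H2']; split;
  [now apply range_power_subspace | now apply graph_plus].
Qed.

Lemma restr_graph_scal (k : C) x y : G x y -> G (scal k x) (scal k y).
Proof.
intros [H1 H2]; split; [now apply range_power_subspace | now apply graph_scal].
Qed.

(* The operator S_m: the restriction of [S] to the range of S^m, acting in that
   range. *)
Definition range_restriction : linear_operator X :=
  {| carrier := E;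
     graph := G;
     carrier_subspace := range_power_subspace;
     graph_carrier := restr_graph_carrier;
     graph_functional := restr_graph_functional;
     graph_zero := restr_graph_zero;
     graph_plus := restr_graph_plus;
     graph_scal := restr_graph_scal |}.

End Restriction.

Definition semi_regular {X : CompleteNormedModule C_AbsRing} (S : linear_operator X)
    : Prop :=
  closed_in (carrier S) (range S) /\ (forall x, kernel S x -> hyperrange S x).

Definition Fredholm {X : CompleteNormedModule C_AbsRing} (S : linear_operator X)
    : Prop :=
  finite_dimensional (kernel S)
  /\ closed_in (carrier S) (range S)
  /\ finite_codimension_in (carrier S) (range S).

Definition quasi_Fredholm {X : CompleteNormedModule C_AbsRing} (S : linear_operator X)
    : Prop :=
  exists m : nat,
    closed_in (carrier S) (range (power S m)) /\ semi_regular (range_restriction S m).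

Definition B_Fredholm {X : CompleteNormedModule C_AbsRing} (S : linear_operator X)
    : Prop :=
  exists m : nat,
    closed_in (carrier S) (range (power S m)) /\ Fredholm (range_restriction S m).

(* [Glb_Rbar] of the empty set is [p_infty]. *)
Definition ascent {X : CompleteNormedModule C_AbsRing} (S : linear_operator X) : Rbar :=
  Glb_Rbar (fun r => exists m : nat, r = INR m /\
    forall x, kernel (power S m) x <-> kernel (power S (Datatypes.S m)) x).

Definition descent {X : CompleteNormedModule C_AbsRing} (S : linear_operator X) : Rbar :=
  Glb_Rbar (fun r => exists m : nat, r = INR m /\
    forall x, range (power S m) x <-> range (power S (Datatypes.S m)) x).

Definition Drazin_invertible {X : CompleteNormedModule C_AbsRing}
    (S : linear_operator X) : Prop :=
  is_finite (ascent S) /\ is_finite (descent S).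

(* Only the values at times [t >= 0] are meaningful.  Coquelicot's [is_linear]
   includes boundedness. *)
Record C0_semigroup (X : CompleteNormedModule C_AbsRing) := C0Semigroup {
  semigroup :> R -> X -> X;
  semigroup_linear : forall t, 0 <= t -> is_linear (semigroup t);
  semigroup_0 : forall x, semigroup 0 x = x;
  semigroup_plus : forall s t x, 0 <= s -> 0 <= t ->
    semigroup (s + t) x = semigroup s (semigroup t x);
  semigroup_continuous : forall x,
    filterlim (fun t => semigroup t x) (at_right 0) (locally x)
}.

Arguments semigroup {X} T _ _ : rename.
Arguments semigroup_linear {X} T t _ : rename.
Arguments semigroup_0 {X} T x : rename.
Arguments semigroup_plus {X} T s t x _ _ : rename.
Arguments semigroup_continuous {X} T x : rename.

Lemma minus_plus_plus {G : AbelianGroup} (a b c d : G) :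
  plus (minus a b) (minus c d) = minus (plus a c) (plus b d).
Proof.
unfold minus; rewrite (opp_plus b d), <- !plus_assoc; f_equal.
rewrite !plus_assoc; f_equal; apply plus_comm.
Qed.

Section Generator.
Context {X : CompleteNormedModule C_AbsRing}.
Context (T : C0_semigroup X).

Definition generator_graph (x y : X) : Prop :=
  filterlim (fun h : R => scal (RtoC (/ h) : C_AbsRing) (minus (T h x) x))
    (at_right 0) (locally y).

Lemma full_subspace : is_subspace (fun _ : X => True).
Proof. repeat split. Qed.

Lemma generator_graph_functional x y z :
  generator_graph x y -> generator_graph x z -> y = z.
Proof.
intros Hy Hz.
apply (filterlim_locally_unique (F := at_right 0) _ _ _ Hy Hz).
Qed.

Lemma at_right_pos (P : R -> Prop) : (forall h, 0 < h -> P h) -> at_right 0 P.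
Proof. intros H; exists posreal_one; intros h _ Hh; exact (H h Hh). Qed.

Lemma generator_graph_plus x y x' y' :
  generator_graph x y -> generator_graph x' y' ->
  generator_graph (plus x x') (plus y y').
Proof.
intros H H'.
pose proof (filterlim_comp_2 _ _ plus H H' (filterlim_plus y y')) as Hp.
revert Hp; apply filterlim_ext_loc, at_right_pos; intros h Hh.
pose proof (linear_plus _ (semigroup_linear T h (Rlt_le _ _ Hh)) x x') as HT.
change (T h (plus x x') = plus (T h x) (T h x')) in HT.
rewrite HT.
etransitivity; [symmetry; apply scal_distr_l | f_equal;
  exact (minus_plus_plus (G := X) (T h x) x (T h x') x')].
Qed.

Lemma generator_graph_scal (k : C) x y :
  generator_graph x y -> generator_graph (scal k x) (scal k y).
Proof.
intros H.
pose proof (filterlim_comp _ _ _ _ _ _ _ _ H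
              (filterlim_scal_r (k : C_AbsRing) y)) as Hp.
revert Hp; apply filterlim_ext_loc, at_right_pos; intros h Hh.
pose proof (linear_scal _ (semigroup_linear T h (Rlt_le _ _ Hh)) k x) as HT.
change (T h (scal k x) = scal k (T h x)) in HT.
rewrite HT.
transitivity (scal (mult (k : C_AbsRing) (RtoC (/ h))) (minus (T h x) x)).
- apply scal_assoc.
- rewrite (Cmult_comm k (RtoC (/ h)) : mult (k : C_AbsRing) _ = mult _ k).
  etransitivity; [symmetry; apply scal_assoc | f_equal].
  exact (scal_minus_distr_l (V := X) k (T h x) x).
Qed.

Lemma generator_graph_zero : generator_graph zero zero.
Proof.
unfold generator_graph.
apply filterlim_ext_loc with (fun _ => zero); [| apply filterlim_const].
apply at_right_pos; intros h Hh.
assert (HT : T h zero = zero).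
{ transitivity (T h (scal (zero : C_AbsRing) zero)).
  - f_equal; symmetry; exact (scal_zero_l (V := X) zero).
  - etransitivity; [apply (linear_scal _ (semigroup_linear T h (Rlt_le _ _ Hh))) |].
    exact (scal_zero_l (V := X) (T h zero)). }
rewrite HT; symmetry.
etransitivity;
  [apply f_equal, (minus_eq_zero (G := X) zero) | exact (scal_zero_r (V := X) (RtoC (/ h)))].
Qed.

Definition generator : linear_operator X :=
  {| carrier := fun _ => True;
     graph := generator_graph;
     carrier_subspace := full_subspace;
     graph_carrier := fun _ _ _ => conj I I;
     graph_functional := generator_graph_functional;
     graph_zero := generator_graph_zero;
     graph_plus := generator_graph_plus;
     graph_scal := generator_graph_scal |}.

End Generator.

(* Meaningful for bounded [f], for which the least upper bound is finite. *)
Definition operator_norm {X : CompleteNormedModule C_AbsRing} (f : X -> X) : R :=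
  real (Lub_Rbar (fun r => exists x, norm x <= 1 /\ r = norm (f x))).

(* Main.v *)
Require Import Defs.
From Stdlib Require Import Reals.
From Coquelicot Require Import Coquelicot.
From Stdlib Require Import Lra Lia ClassicalEpsilon.
Open Scope R_scope.

(* If A^n x = y and A y = 0, then (T(t) - I)^n x = t^n y, so that
   T(t) (T(t) - I)^n x = t^n y; the growth hypothesis makes the left-hand side
   o(t^n), hence N(A) and R(A^n) meet only in 0.  The same hypothesis gives
   every l > 0 in the resolvent set.

   If A is quasi-Fredholm, A_m is therefore injective with closed range, so it
   is bounded below, and (l - A)^-1 z stays bounded as l -> 0 for z in R(A^m);
   thus A_m has dense, hence full, range and the descent is at most m.  If A
   has finite descent, R(A^p) is closed for large p by the open mapping theorem
   applied to the bounded operator C = A (l - A)^-1, for which R(C^k) = R(A^k),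
   and A_p is bijective.  If A is B-Fredholm, all the ranges R(A^(m+k)) =
   R(C^(m+k)) are closed by Kato's theorem on ranges of finite codimension, and
   the quasi-Fredholm argument applies to A_(m+n). *)

(** That N(A) meets R(A^n) only in 0 bounds the ascent by n, so Drazin invertibility comes down to
    finite descent. The obstacle is a mismatch of levels: injectivity is known on R(A^n), whereas an
    index m taken from a definition controls only R(A^m) and R(A^(m+1)). Semi-regularity bridges it
    by placing the kernel of A_m in R^\infty(A_m); a Fredholm A_m offers no such inclusion, so the
    level is raised to m + n and closedness has to be carried up with it. The operator C enters
    because A^k is unbounded, with a graph that is not visibly closed, while C^k is bounded and
    everywhere defined with the same range. The resolvent at l > 0 comes from S(t) = exp(- l t)
    T(t): A - l carries the integral of S over [0, t] to S(t) - I, which is inverted by a Neumann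
    series at a time t where S(t) has norm at most 1/2. The integral is only ever a limit of Riemann
    sums. *)

(** * Identities between linear combinations, by reflection *)

Section VectorIdentities.
Context {X : CompleteNormedModule C_AbsRing}.

Definition rscal (r : R) (x : X) : X := scal (RtoC r : C_AbsRing) x.

(** Syntax for proof by reflection: two expressions have the same value once their complex
    coefficients agree atom by atom. Only soundness is claimed, since the atoms may be linearly
    dependent. *)
Inductive vexpr :=
| VAtom (i : nat)
| VZero
| VPlus (e f : vexpr)
| VOpp (e : vexpr)
| VScal (k : C) (e : vexpr).

Fixpoint veval (env : nat -> X) (e : vexpr) : X :=
  match e with
  | VAtom i => env i
  | VZero => zero
  | VPlus e f => plus (veval env e) (veval env f)
  | VOpp e => opp (veval env e)
  | VScal k e => scal (k : C_AbsRing) (veval env e)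
  end.

Fixpoint vcoef (e : vexpr) (i : nat) : C :=
  match e with
  | VAtom j => if Nat.eqb i j then RtoC 1 else RtoC 0
  | VZero => RtoC 0
  | VPlus e f => Cplus (vcoef e i) (vcoef f i)
  | VOpp e => Copp (vcoef e i)
  | VScal k e => Cmult k (vcoef e i)
  end.

Fixpoint vbound (n : nat) (e : vexpr) : Prop :=
  match e with
  | VAtom j => Nat.ltb j n = true
  | VZero => True
  | VPlus e f => vbound n e /\ vbound n f
  | VOpp e => vbound n e
  | VScal _ e => vbound n e
  end.

Fixpoint vsum (n : nat) (c : nat -> C) (env : nat -> X) : X :=
  match n with
  | O => zero
  | S k => plus (vsum k c env) (scal (c k : C_AbsRing) (env k))
  end.

Fixpoint vagree (n : nat) (e f : vexpr) : Prop :=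
  match n with
  | O => True
  | S k => vcoef e k = vcoef f k /\ vagree k e f
  end.

Lemma plus_plus_swap (a b c d : X) :
  plus (plus a b) (plus c d) = plus (plus a c) (plus b d).
Proof.
rewrite <- !plus_assoc; f_equal; rewrite !plus_assoc; f_equal; apply plus_comm.
Qed.

Lemma vsum_plus n c d env :
  vsum n (fun i => Cplus (c i) (d i)) env = plus (vsum n c env) (vsum n d env).
Proof.
induction n as [|n IH]; simpl.
- symmetry; apply plus_zero_l.
- rewrite IH, plus_plus_swap; f_equal.
  exact (scal_distr_r (V := X) (c n : C_AbsRing) (d n) (env n)).
Qed.

Lemma vsum_scal n (k : C) c env :
  vsum n (fun i => Cmult k (c i)) env = scal (k : C_AbsRing) (vsum n c env).
Proof.
induction n as [|n IH]; simpl.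
- symmetry; exact (scal_zero_r (V := X) (k : C_AbsRing)).
- rewrite IH.
  transitivity (plus (scal (k : C_AbsRing) (vsum n c env))
     (scal (k : C_AbsRing) (scal (c n : C_AbsRing) (env n)))).
  + f_equal; symmetry; exact (scal_assoc (V := X) (k : C_AbsRing) (c n) (env n)).
  + symmetry; exact (scal_distr_l (V := X) (k : C_AbsRing) _ _).
Qed.

Lemma vsum_ext n c d env : (forall i, (i < n)%nat -> c i = d i) ->
  vsum n c env = vsum n d env.
Proof.
induction n as [|n IH]; simpl; intros H; [reflexivity|].
rewrite IH by (intros; apply H; lia). rewrite H by lia. reflexivity.
Qed.

Lemma scal_C0 (x : X) : scal (RtoC 0 : C_AbsRing) x = zero.
Proof. exact (scal_zero_l (V := X) x). Qed.

Lemma scal_C1 (x : X) : scal (RtoC 1 : C_AbsRing) x = x.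
Proof. exact (scal_one (V := X) x). Qed.

Lemma vsum_zero n env : vsum n (fun _ => RtoC 0) env = zero.
Proof.
induction n as [|n IH]; simpl; [reflexivity|].
rewrite IH, scal_C0; apply plus_zero_l.
Qed.

Lemma scal_Cm1 (x : X) : scal (Copp (RtoC 1) : C_AbsRing) x = opp x.
Proof. exact (scal_opp_one (V := X) x). Qed.

Lemma vsum_atom n j env : (j < n)%nat ->
  vsum n (fun i => if Nat.eqb i j then RtoC 1 else RtoC 0) env = env j.
Proof.
induction n as [|n IH]; intros H; [lia|]; simpl.
destruct (Nat.eq_dec n j) as [->|Hn].
- rewrite Nat.eqb_refl, scal_C1.
  rewrite (vsum_ext _ _ (fun _ => RtoC 0)).
  + rewrite vsum_zero; apply plus_zero_l.
  + intros i Hi; destruct (Nat.eqb_spec i j); [lia|reflexivity].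
- destruct (Nat.eqb_spec n j); [lia|].
  rewrite IH, scal_C0 by lia; apply plus_zero_r.
Qed.

Lemma veval_vsum n env e : vbound n e -> veval env e = vsum n (vcoef e) env.
Proof.
induction e as [j| |e IHe f IHf|e IHe|k e IHe]; simpl; intros H.
- symmetry; apply vsum_atom; now apply Nat.ltb_lt.
- symmetry; apply vsum_zero.
- rewrite IHe, IHf by tauto; symmetry; apply vsum_plus.
- rewrite IHe by assumption.
  transitivity (scal (Copp (RtoC 1) : C_AbsRing) (vsum n (vcoef e) env)).
  + symmetry; apply scal_Cm1.
  + rewrite <- vsum_scal; apply vsum_ext; intros i _; ring.
- rewrite IHe by assumption; symmetry; apply vsum_scal.
Qed.

Lemma veval_eq n env e f :
  vbound n e -> vbound n f -> vagree n e f -> veval env e = veval env f.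
Proof.
intros He Hf H; rewrite (veval_vsum n), (veval_vsum n env f) by assumption.
apply vsum_ext; clear He Hf; revert H; induction n as [|n IH]; simpl; intros H i Hi; [lia|].
destruct (Nat.eq_dec i n) as [->|]; [tauto|apply IH; [tauto|lia]].
Qed.

End VectorIdentities.

Ltac v_mem a l :=
  match l with
  | nil => constr:(false)
  | cons a _ => constr:(true)
  | cons _ ?l' => v_mem a l'
  end.

Ltac v_atoms l t :=
  match t with
  | plus ?a ?b => let l' := v_atoms l a in v_atoms l' b
  | minus ?a ?b => let l' := v_atoms l a in v_atoms l' b
  | opp ?a => v_atoms l a
  | scal _ ?a => v_atoms l a
  | rscal _ ?a => v_atoms l a
  | zero => l
  | _ => let b := v_mem t l in
         match b with true => l | false => constr:(cons t l) end
  end.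

Ltac v_index a l :=
  match l with
  | cons a _ => constr:(O)
  | cons _ ?l' => let i := v_index a l' in constr:(S i)
  end.

Ltac v_reify l t :=
  match t with
  | plus ?a ?b => let a' := v_reify l a in let b' := v_reify l b in constr:(VPlus a' b')
  | minus ?a ?b =>
      let a' := v_reify l a in let b' := v_reify l b in constr:(VPlus a' (VOpp b'))
  | opp ?a => let a' := v_reify l a in constr:(VOpp a')
  | scal ?k ?a => let a' := v_reify l a in constr:(VScal k a')
  | rscal ?r ?a => let a' := v_reify l a in constr:(VScal (RtoC r) a')
  | zero => constr:(VZero)
  | _ => let i := v_index t l in constr:(VAtom i)
  end.

(* Reduces an identity between linear combinations of vectors to the equality
   of the real and imaginary parts of the coefficients. *)
Ltac vec_coefficients :=
  match goal with
  | |- @eq ?T ?a ?b =>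
    let l := v_atoms (@nil T) a in
    let l := v_atoms l b in
    let e := v_reify l a in
    let f := v_reify l b in
    let n := eval cbv in (length l) in
    (* [minus] and [rscal] have no constructor of their own: conversion identifies them with
       [VPlus], [VOpp] and [VScal]. *)
    change (veval (fun i => List.nth i l zero) e = veval (fun i => List.nth i l zero) f);
    apply (veval_eq n);
    [ cbn; repeat split | cbn; repeat split
    | cbn [vagree vcoef Nat.eqb]; repeat split; apply injective_projections; cbn ]
  end.

Ltac vec := vec_coefficients; ring.
Ltac vec_field := vec_coefficients; field.

(* These fix the canonical structure paths, which elaboration otherwise chooses
   differently for nested terms: [rewrite] and [lra] would not identify them. *)
Local Notation zero := (@Hierarchy.zero (CompleteNormedModule.AbelianMonoid C_AbsRing _)).
Local Notation plus := (@Hierarchy.plus (CompleteNormedModule.AbelianMonoid C_AbsRing _)).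
Local Notation opp := (@Hierarchy.opp (CompleteNormedModule.AbelianGroup C_AbsRing _)).
Local Notation minus := (@Hierarchy.minus (CompleteNormedModule.AbelianGroup C_AbsRing _)).
Local Notation norm :=
  (@Hierarchy.norm C_AbsRing (CompleteNormedModule.NormedModule C_AbsRing _)).
Local Notation scal := (@Hierarchy.scal _ (CompleteNormedModule.ModuleSpace C_AbsRing _)).

(** * Norm estimates and convergence *)

Section Norm.
Context {X : CompleteNormedModule C_AbsRing}.
Implicit Types x y z : X.

Lemma norm_plus_le x y : norm (plus x y) <= norm x + norm y.
Proof. exact (norm_triangle (V := X) x y). Qed.

Lemma norm_opp_eq x : norm (opp x) = norm x.
Proof. exact (norm_opp (V := X) x). Qed.

Lemma norm_minus_le x y : norm (minus x y) <= norm x + norm y.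
Proof. rewrite <- (norm_opp_eq y); apply norm_plus_le. Qed.

Lemma norm_minus_sym x y : norm (minus x y) = norm (minus y x).
Proof. rewrite <- norm_opp_eq; f_equal; vec. Qed.

Lemma norm_scal_le (k : C) x : norm (scal (k : C_AbsRing) x) <= Cmod k * norm x.
Proof. exact (norm_scal (V := X) (k : C_AbsRing) x). Qed.

Lemma norm_rscal_le (r : R) x : norm (rscal r x) <= Rabs r * norm x.
Proof. rewrite <- Cmod_R; apply norm_scal_le. Qed.

Lemma norm_rscal_nonneg (r : R) x : 0 <= r -> norm (rscal r x) <= r * norm x.
Proof.
intros Hr; pose proof (norm_rscal_le r x) as H; rewrite Rabs_pos_eq in H; assumption.
Qed.

Lemma norm_nonneg x : 0 <= norm x.
Proof. exact (norm_ge_0 (V := X) x). Qed.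

Lemma norm_zero_eq : norm (zero : X) = 0.
Proof. exact (norm_zero (V := X)). Qed.

Lemma norm_minus_trans x y z : norm (minus x z) <= norm (minus x y) + norm (minus y z).
Proof.
replace (minus x z) with (plus (minus x y) (minus y z)) by vec; apply norm_plus_le.
Qed.

Lemma norm_le_minus x y : norm x <= norm (minus x y) + norm y.
Proof. replace x with (plus (minus x y) y) at 1 by vec; apply norm_plus_le. Qed.

(** Lets an estimate end with any fixed multiple of [eps], so that constants need no tuning
    beforehand. Dividing by [c + 1] instead of [c] covers [c = 0]. *)
Lemma le_epsilon_scaled (a b c : R) :
  0 <= c -> (forall eps, 0 < eps -> a <= b + c * eps) -> a <= b.
Proof.
intros Hc H; apply le_epsilon; intros e He.
assert (He' : 0 < e / (c + 1)) by (apply Rdiv_lt_0_compat; lra).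
specialize (H _ He').
assert (c * (e / (c + 1)) <= e); [|lra].
replace (c * (e / (c + 1))) with (e - e / (c + 1)) by (field; lra); lra.
Qed.

Lemma norm_small_zero (c : R) x :
  0 <= c -> (forall eps, 0 < eps -> norm x <= c * eps) -> x = zero.
Proof.
intros Hc H; apply (norm_eq_zero (V := X)); apply Rle_antisym; [|apply norm_nonneg].
apply (le_epsilon_scaled _ _ c Hc); intros e He; rewrite Rplus_0_l; auto.
Qed.

Lemma minus_zero_eq x y : minus x y = zero -> x = y.
Proof.
intros H; transitivity (plus (minus x y) y); [vec|]; rewrite H; vec.
Qed.

Lemma norm_small_eq (c : R) x y :
  0 <= c -> (forall eps, 0 < eps -> norm (minus x y) <= c * eps) -> x = y.
Proof. intros Hc H; apply minus_zero_eq, (norm_small_zero c); assumption. Qed.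

Lemma locally_norm_iff x (P : X -> Prop) :
  locally x P <-> exists d, 0 < d /\ forall y, norm (minus y x) < d -> P y.
Proof.
split.
- intros [d Hd]; exists d; split; [apply cond_pos|].
  intros y Hy; apply Hd; exact (norm_compat1 (V := X) x y d Hy).
- intros (d & Hd & H).
  destruct (locally_le_locally_norm (V := X) x P (ex_intro _ (mkposreal d Hd) H)) as [e He].
  exists e; exact He.
Qed.

(** The adherent-point form of closedness, in which every limit argument is run; [closed_in_iff]
    relates it to the filter form of [closed_in]. *)
Definition norm_closed (V : X -> Prop) : Prop :=
  forall x, (forall eps, 0 < eps -> exists y, V y /\ norm (minus y x) < eps) -> V x.

Lemma closed_in_iff (E V : X -> Prop) : (forall x, V x -> E x) ->
  closed_in E V <->
  (forall x, E x -> (forall eps, 0 < eps -> exists y, V y /\ norm (minus y x) < eps) -> V x).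
Proof.
intros HV; split; intros H x Hx Hadh; apply (H x Hx).
- intros Hloc; apply locally_norm_iff in Hloc; destruct Hloc as (d & Hd & Hloc).
  destruct (Hadh d Hd) as (y & Hy & Hyx).
  exact (Hloc y Hyx (HV y Hy) Hy).
- intros eps Heps; apply NNPP; intros Hno; apply Hadh.
  apply locally_norm_iff; exists eps; split; [exact Heps|].
  intros y Hy _ HVy; apply Hno; now exists y.
Qed.

Definition tends_to (u : nat -> X) (x : X) : Prop :=
  forall eps, 0 < eps -> exists N, forall n, (N <= n)%nat -> norm (minus (u n) x) < eps.

Lemma cauchy_tends_to (u : nat -> X) :
  (forall eps, 0 < eps -> exists N, forall n m, (N <= n)%nat -> (N <= m)%nat ->
     norm (minus (u n) (u m)) < eps) -> exists x, tends_to u x.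
Proof.
intros Hu.
set (F := filtermap u eventually).
assert (PF : ProperFilter F) by (apply filtermap_proper_filter, eventually_filter).
assert (CF : cauchy (T := X) F).
{ intros eps.
  destruct (Hu eps (cond_pos eps)) as [N HN]; exists (u N); exists N; intros n Hn.
  apply (norm_compat1 (V := X)); now apply HN. }
exists (lim F); intros eps Heps.
assert (Hl : locally (lim F) (fun y : X => norm (minus y (lim F)) < eps))
  by (apply locally_norm_iff; exists eps; auto).
destruct Hl as [d Hd].
destruct (complete_cauchy F PF CF d) as [N HN].
exists N; intros n Hn; apply Hd; now apply HN.
Qed.

Lemma tends_to_norm_le (u : nat -> X) x y (r : R) N :
  tends_to u x -> (forall n, (N <= n)%nat -> norm (minus (u n) y) <= r) ->
  norm (minus x y) <= r.
Proof.
intros Hu Hr; apply le_epsilon; intros e He.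
destruct (Hu e He) as [M HM].
pose proof (HM (N + M)%nat ltac:(lia)); pose proof (Hr (N + M)%nat ltac:(lia)).
pose proof (norm_minus_trans x (u (N + M)%nat) y).
rewrite (norm_minus_sym x (u (N + M)%nat)) in *; lra.
Qed.

(** The finite geometric sum is kept exact through the factor [1 - (1 / 2) ^ m], which is what makes
    the induction on [m] close. *)
Lemma geometric_steps (u : nat -> X) (c : R) :
  (forall n, norm (minus (u (S n)) (u n)) <= c * (1 / 2) ^ n) ->
  forall n m, norm (minus (u (n + m)%nat) (u n)) <= 2 * c * (1 / 2) ^ n * (1 - (1 / 2) ^ m).
Proof.
intros H n m; induction m as [|m IH].
- rewrite Nat.add_0_r; replace (minus (u n) (u n)) with (zero : X) by vec.
  rewrite norm_zero_eq; simpl; lra.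
- rewrite Nat.add_succ_r.
  pose proof (norm_minus_trans (u (S (n + m))) (u (n + m)%nat) (u n)) as H1.
  specialize (H (n + m)%nat); rewrite pow_add in H; simpl.
  replace (2 * c * (1 / 2) ^ n * (1 - 1 / 2 * (1 / 2) ^ m))
    with (c * ((1 / 2) ^ n * (1 / 2) ^ m) + 2 * c * (1 / 2) ^ n * (1 - (1 / 2) ^ m))
    by field.
  lra.
Qed.

Lemma pow_half_small (c eps : R) : 0 < eps ->
  exists N, forall n, (N <= n)%nat -> c * (1 / 2) ^ n < eps.
Proof.
intros Heps.
assert (Hc : 0 < Rabs c + 1) by (pose proof (Rabs_pos c); lra).
destruct (pow_lt_1_zero (1 / 2) ltac:(rewrite Rabs_pos_eq; lra) (eps / (Rabs c + 1)))
  as [N HN]; [apply Rdiv_lt_0_compat; lra|].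
exists N; intros n Hn; specialize (HN n Hn).
pose proof (pow_lt (1 / 2) n ltac:(lra)) as Hp.
rewrite Rabs_pos_eq in HN by lra.
apply (Rmult_lt_compat_r (Rabs c + 1)) in HN; [|lra].
replace (eps / (Rabs c + 1) * (Rabs c + 1)) with eps in HN by (field; lra).
pose proof (Rle_abs c); nra.
Qed.

Lemma geometric_tends_to (u : nat -> X) (c : R) :
  (forall n, norm (minus (u (S n)) (u n)) <= c * (1 / 2) ^ n) ->
  exists x, tends_to u x /\ forall n, norm (minus x (u n)) <= 2 * c * (1 / 2) ^ n.
Proof.
intros H.
assert (Hc : 0 <= c) by (specialize (H O); simpl in H; pose proof (norm_nonneg (minus (u 1%nat) (u O))); lra).
assert (Hg : forall n k, (n <= k)%nat -> norm (minus (u k) (u n)) <= 2 * c * (1 / 2) ^ n).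
{ intros n k Hk; replace k with (n + (k - n))%nat by lia.
  pose proof (geometric_steps u c H n (k - n)).
  pose proof (pow_lt (1 / 2) n ltac:(lra)); pose proof (pow_lt (1 / 2) (k - n) ltac:(lra)).
  assert (0 <= 2 * c * (1 / 2) ^ n) by (apply Rmult_le_pos; lra); nra. }
assert (Hx : exists x, tends_to u x).
{ apply cauchy_tends_to; intros eps Heps.
  destruct (pow_half_small (4 * c) eps Heps) as [N HN]; exists N; intros n m Hn Hm.
  pose proof (Hg N n Hn); pose proof (Hg N m Hm).
  pose proof (norm_minus_trans (u n) (u N) (u m)).
  rewrite (norm_minus_sym (u N) (u m)) in *; specialize (HN N (le_n N)); lra. }
destruct Hx as [x Hx]; exists x; split; [exact Hx|]; intros n.
apply (tends_to_norm_le u x (u n) _ n Hx); intros k Hk; now apply Hg.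
Qed.

(** * Baire's theorem and the open mapping theorem for closed relations *)

(** Baire's theorem for sets that may fail to be closed: one of the [P k] covering [Z] is dense in a
    relative ball of [Z]. Otherwise balls can be nested so that the k-th choice avoids [P k], and
    their common point lies in no [P k]. *)
Lemma baire (Z : X -> Prop) (P : nat -> X -> Prop) :
  norm_closed Z -> (exists z, Z z) ->
  (forall z, Z z -> exists k, P k z) ->
  exists k z0 r, Z z0 /\ 0 < r /\
    forall z, Z z -> norm (minus z z0) < r -> forall eps, 0 < eps ->
      exists u, Z u /\ P k u /\ norm (minus z u) < eps.
Proof.
intros HZ [z0 Hz0] HP; apply NNPP; intros Hno.
set (ball_ok := fun b : X * R => Z (fst b) /\ 0 < snd b).
assert (step : forall k b, exists b', ball_ok b ->
   ball_ok b' /\ norm (minus (fst b') (fst b)) <= snd b / 2 /\ snd b' <= snd b / 2 /\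
   forall u, Z u -> norm (minus u (fst b')) <= snd b' -> ~ P k u).
(* A degenerate pair is returned unchanged, which makes the step total and lets choice produce a
   function. *)
{ intros k b; destruct (classic (ball_ok b)) as [Hb|Hb]; [|exists b; tauto].
  destruct b as [x r]; destruct Hb as [Hx Hr]; simpl in *.
  assert (Hz : exists z eps, Z z /\ norm (minus z x) < r / 2 /\ 0 < eps /\
             forall u, Z u -> norm (minus z u) < eps -> ~ P k u).
  { apply NNPP; intros Hn; apply Hno; exists k, x, (r / 2); split; [exact Hx|].
    split; [lra|]; intros z Hz Hzx eps Heps; apply NNPP; intros Hn'; apply Hn.
    exists z, eps; repeat split; auto.
    intros u Hu Hzu HPu; apply Hn'; exists u; auto. }
  destruct Hz as (z & eps & Hz & Hzx & Heps & Hu).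
  (* At most half of [eps], so that the closed ball avoids [P k]; at most half of [r], so that the
     radii decay geometrically. *)
  exists (z, Rmin (r / 2) (eps / 2)); intros _; simpl.
  assert (H2 : 0 < Rmin (r / 2) (eps / 2)) by (apply Rmin_pos; lra).
  pose proof (Rmin_l (r / 2) (eps / 2)); pose proof (Rmin_r (r / 2) (eps / 2)).
  repeat split; simpl; try lra; auto.
  intros u HZu Hle; apply Hu; [exact HZu|]; rewrite norm_minus_sym; lra. }
set (next := fun k b => proj1_sig (constructive_indefinite_description _ (step k b))).
set (seq := fix seq k := match k with O => (z0, 1) | S k => next k (seq k) end).
assert (Hok : forall k, ball_ok (seq k)).
{ induction k as [|k IH]; [split; simpl; [exact Hz0|lra]|].
  exact (proj1 (proj2_sig (constructive_indefinite_description _ (step k (seq k))) IH)). }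
assert (Hnext : forall k,
   norm (minus (fst (seq (S k))) (fst (seq k))) <= snd (seq k) / 2 /\
   snd (seq (S k)) <= snd (seq k) / 2 /\
   forall u, Z u -> norm (minus u (fst (seq (S k)))) <= snd (seq (S k)) -> ~ P k u).
{ intros k.
  exact (proj2 (proj2_sig (constructive_indefinite_description _ (step k (seq k))) (Hok k))). }
assert (Hrad : forall k j, snd (seq (k + j)%nat) <= snd (seq k) * (1 / 2) ^ j).
{ intros k j; induction j as [|j IH]; [rewrite Nat.add_0_r; simpl; lra|].
  rewrite Nat.add_succ_r; destruct (Hnext (k + j)%nat) as (_ & H & _).
  cbn [pow]; lra. }
assert (Hstep : forall k j,
  norm (minus (fst (seq (k + S j)%nat)) (fst (seq (k + j)%nat))) <= snd (seq k) / 2 * (1 / 2) ^ j).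
{ intros k j; rewrite Nat.add_succ_r; destruct (Hnext (k + j)%nat) as (H & _ & _).
  specialize (Hrad k j); lra. }
destruct (geometric_tends_to (fun j => fst (seq j)) (1 / 2)) as (x & Hx & _).
{ intros j; exact (Hstep O j). }
assert (Hball : forall k, norm (minus x (fst (seq k))) <= snd (seq k)).
{ intros k; apply (tends_to_norm_le (fun j => fst (seq j)) x _ _ k Hx); intros j Hj.
  pose proof (geometric_steps (fun j => fst (seq (k + j)%nat)) _ (Hstep k) O (j - k)) as H.
  simpl in H; rewrite Nat.add_0_r in H.
  replace (k + (j - k))%nat with j in H by lia.
  destruct (Hok k) as [_ Hk]; pose proof (pow_lt (1 / 2) (j - k) ltac:(lra)); nra. }
assert (HZx : Z x).
{ apply HZ; intros eps Heps; destruct (Hx eps Heps) as [N HN].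
  exists (fst (seq N)); split; [apply Hok|now apply HN]. }
destruct (HP x HZx) as [k Hk].
exact (proj2 (proj2 (Hnext k)) x HZx (Hball (S k)) Hk).
Qed.

(** A closed linear subspace of the product of [X] with itself. Multivalued relations are allowed,
    so that one open mapping theorem serves the generator, its restrictions to ranges, equations
    [D x = E y] and ranges enlarged by a vector. *)
Record closed_relation (G : X -> X -> Prop) : Prop := {
  rel_zero : G zero zero;
  rel_plus : forall x y x' y', G x y -> G x' y' -> G (plus x x') (plus y y');
  rel_scal : forall (k : C) x y, G x y ->
    G (scal (k : C_AbsRing) x) (scal (k : C_AbsRing) y);
  rel_closed : forall x y,
    (forall eps, 0 < eps ->
       exists x' y', G x' y' /\ norm (minus x' x) < eps /\ norm (minus y' y) < eps) ->
    G x y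
}.

Lemma rel_rscal G (HG : closed_relation G) r x y : G x y -> G (rscal r x) (rscal r y).
Proof. exact (rel_scal G HG (RtoC r) x y). Qed.

Lemma rel_minus G (HG : closed_relation G) x y x' y' :
  G x y -> G x' y' -> G (minus x x') (minus y y').
Proof.
intros H H'.
replace (minus x x') with (plus x (rscal (-1) x')) by vec.
replace (minus y y') with (plus y (rscal (-1) y')) by vec.
apply (rel_plus G HG); [exact H|now apply rel_rscal].
Qed.

(** The Neumann series in relational form: each remainder is solved up to half its norm, the partial
    solutions form a geometric series, and closedness passes to the limit. The factor 2 is the sum
    of that series. *)
Lemma successive_approximation (G : X -> X -> Prop) (Z : X -> Prop) (K : R) :
  closed_relation G -> 0 <= K ->
  (forall z, Z z -> exists y z', G y z' /\ Z (minus z z') /\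
     norm y <= K * norm z /\ norm (minus z z') <= norm z / 2) ->
  forall z, Z z -> exists y, G y z /\ norm y <= 2 * K * norm z.
Proof.
intros HG HK H z Hz.
assert (step : forall z, exists p : X * X, Z z -> G (fst p) (snd p) /\ Z (minus z (snd p)) /\
     norm (fst p) <= K * norm z /\ norm (minus z (snd p)) <= norm z / 2).
{ intros x; destruct (classic (Z x)) as [Hx|Hx]; [|exists (x, x); tauto].
  destruct (H x Hx) as (y & z' & Hy); exists (y, z'); auto. }
set (app := fun x => proj1_sig (constructive_indefinite_description _ (step x))).
assert (Happ : forall x, Z x -> G (fst (app x)) (snd (app x)) /\ Z (minus x (snd (app x))) /\
     norm (fst (app x)) <= K * norm x /\ norm (minus x (snd (app x))) <= norm x / 2).
{ intros x; exact (proj2_sig (constructive_indefinite_description _ (step x))). }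
(* the pair (partial sum of the approximate solutions, remainder) *)
set (seq := fix seq k := match k with
  | O => (zero : X, z)
  | S k => (plus (fst (seq k)) (fst (app (snd (seq k)))),
            minus (snd (seq k)) (snd (app (snd (seq k))))) end).
assert (Hrem : forall k, Z (snd (seq k)) /\ norm (snd (seq k)) <= norm z * (1 / 2) ^ k).
{ induction k as [|k [IH1 IH2]]; [simpl; split; [exact Hz|lra]|].
  destruct (Happ _ IH1) as (_ & H1 & _ & H2); split; [exact H1|].
  change (norm (minus (snd (seq k)) (snd (app (snd (seq k))))) <= norm z * (1 / 2) ^ S k).
  cbn [pow]; lra. }
assert (HGk : forall k, G (fst (seq k)) (minus z (snd (seq k)))).
{ induction k as [|k IH].
  - simpl; replace (minus z z) with (zero : X) by vec; apply HG.
  - change (G (plus (fst (seq k)) (fst (app (snd (seq k)))))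
      (minus z (minus (snd (seq k)) (snd (app (snd (seq k))))))).
    replace (minus z (minus (snd (seq k)) (snd (app (snd (seq k))))))
      with (plus (minus z (snd (seq k))) (snd (app (snd (seq k))))) by vec.
    apply (rel_plus G HG); [exact IH|apply Happ, Hrem]. }
destruct (geometric_tends_to (fun k => fst (seq k)) (K * norm z)) as (y & Hy & Hbound).
{ intros k.
  change (norm (minus (plus (fst (seq k)) (fst (app (snd (seq k))))) (fst (seq k)))
    <= K * norm z * (1 / 2) ^ k).
  replace (minus (plus (fst (seq k)) (fst (app (snd (seq k))))) (fst (seq k)))
    with (fst (app (snd (seq k)))) by vec.
  destruct (Hrem k) as [H1 H2]; destruct (Happ _ H1) as (_ & _ & H3 & _).
  apply (Rmult_le_compat_l K) in H2; [lra|exact HK]. }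
exists y; split.
- apply (rel_closed G HG); intros eps Heps.
  destruct (Hy eps Heps) as [N HN].
  destruct (pow_half_small (norm z) eps Heps) as [N' HN'].
  exists (fst (seq (N + N')%nat)), (minus z (snd (seq (N + N')%nat))).
  split; [apply HGk|split; [apply HN; lia|]].
  replace (minus (minus z (snd (seq (N + N')%nat))) z) with (opp (snd (seq (N + N')%nat)))
    by vec.
  rewrite norm_opp_eq; eapply Rle_lt_trans; [apply Hrem|apply HN'; lia].
- specialize (Hbound O); rewrite pow_O in Hbound.
  change (norm (minus y zero) <= 2 * (K * norm z) * 1) in Hbound.
  replace (minus y zero) with y in Hbound by vec; lra.
Qed.

(** By Baire's theorem the points with a preimage of norm at most k are dense in some relative ball
    of the closed range. Differences of two such points recentre that ball at 0, and successive
    approximation removes the error. *)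
Lemma open_mapping (G : X -> X -> Prop) (Z : X -> Prop) :
  closed_relation G -> norm_closed Z ->
  (forall y z, G y z -> Z z) -> (forall z, Z z -> exists y, G y z) ->
  exists K, 0 <= K /\ forall z, Z z -> exists y, G y z /\ norm y <= K * norm z.
Proof.
intros HG HZ HGZ Honto.
assert (HZsub : forall x y, Z x -> Z y -> Z (minus x y)).
{ intros x y Hx Hy; destruct (Honto x Hx) as [u Hu]; destruct (Honto y Hy) as [v Hv].
  apply (HGZ (minus u v)); now apply rel_minus. }
assert (HZscal : forall r x, Z x -> Z (rscal r x)).
{ intros r x Hx; destruct (Honto x Hx) as [u Hu].
  apply (HGZ (rscal r u)); now apply rel_rscal. }
destruct (baire Z (fun k z => exists y, G y z /\ norm y <= INR k) HZ)
  as (k & z0 & r & Hz0 & Hr & Hdense).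
{ exists zero; apply (HGZ zero), HG. }
{ intros z Hz; destruct (Honto z Hz) as [y Hy].
  destruct (nfloor_ex (norm y) (norm_nonneg y)) as [k Hk].
  exists (S k), y; split; [exact Hy|]; rewrite S_INR; lra. }
(* Two preimages of norm at most k, scaled by [c = 2 * norm z / r], give
   [4 * INR k / r * norm z]. *)
set (K := 4 * INR k / r).
assert (HK : 0 <= K).
{ unfold K; apply Rmult_le_pos; [pose proof (pos_INR k); lra|].
  apply Rlt_le, Rinv_0_lt_compat; exact Hr. }
exists (2 * K); split; [lra|].
apply successive_approximation; auto.
intros z Hz.
destruct (Req_dec (norm z) 0) as [Hz0'|Hnz].
{ exists (zero : X), (zero : X); rewrite norm_zero_eq; split; [apply HG|].
  replace (minus z (zero : X)) with z by vec; rewrite Hz0', Rmult_0_r; repeat split; auto; lra. }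
assert (Hnz' : 0 < norm z) by (pose proof (norm_nonneg z); lra).
set (c := 2 * norm z / r).
assert (Hc : 0 < c) by (apply Rdiv_lt_0_compat; lra).
set (z1 := rscal (/ c) z).
assert (Hz1 : norm z1 <= r / 2).
{ eapply Rle_trans; [apply norm_rscal_nonneg; apply Rlt_le, Rinv_0_lt_compat, Hc|].
  unfold c; apply Req_le; field; lra. }
(* Two errors of at most [r / 8], multiplied by [c], leave half of [norm z]. *)
destruct (Hdense (plus z0 z1)) with (eps := r / 8) as (u & Hu & (y & Hy & Hyk) & Hzu).
{ replace (plus z0 z1) with (minus z0 (rscal (-1) z1)) by vec.
  apply HZsub; auto; now apply HZscal, HZscal. }
{ replace (minus (plus z0 z1) z0) with z1 by vec; lra. }
{ lra. }
destruct (Hdense z0 Hz0) with (eps := r / 8) as (v & Hv & (y' & Hy' & Hyk') & Hzv).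
{ replace (minus z0 z0) with (zero : X) by vec; rewrite norm_zero_eq; exact Hr. }
{ lra. }
exists (rscal c (minus y y')), (rscal c (minus u v)).
split; [apply rel_rscal; auto; now apply rel_minus|].
split; [apply HZsub; auto|].
split.
- eapply Rle_trans; [apply norm_rscal_nonneg; lra|].
  pose proof (norm_minus_le y y') as H.
  apply Rle_trans with (c * (2 * INR k)); [apply Rmult_le_compat_l; lra|].
  unfold c, K; apply Req_le; field; lra.
- replace (minus z (rscal c (minus u v)))
    with (rscal c (minus (minus (plus z0 z1) u) (minus z0 v)))
    by (unfold z1; vec_field; lra).
  eapply Rle_trans; [apply norm_rscal_nonneg; lra|].
  pose proof (norm_minus_le (minus (plus z0 z1) u) (minus z0 v)) as H.
  apply Rle_trans with (c * (r / 4)); [apply Rmult_le_compat_l; lra|].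
  unfold c; apply Req_le; field; lra.
Qed.

End Norm.

(** * Local boundedness of a C_0-semigroup *)

Lemma at_right_0_iff (Q : R -> Prop) :
  at_right 0 Q <-> exists d, 0 < d /\ forall h, 0 < h < d -> Q h.
Proof.
split.
- intros [d Hd]; exists d; split; [apply cond_pos|]; intros h Hh; apply Hd; [|lra].
  change (Rabs (h - 0) < d); rewrite Rabs_pos_eq; lra.
- intros (d & Hd & H); exists (mkposreal d Hd); intros h Hb Hh; apply H.
  change (Rabs (h - 0) < d) in Hb; rewrite Rabs_pos_eq in Hb; lra.
Qed.

Section Semigroup.
Context {X : CompleteNormedModule C_AbsRing}.
Implicit Types (x y z : X) (T : C0_semigroup X).

Lemma filterlim_at_right_0_iff (f : R -> X) y :
  filterlim f (at_right 0) (locally y) <->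
  forall eps, 0 < eps -> exists d, 0 < d /\ forall h, 0 < h < d -> norm (minus (f h) y) < eps.
Proof.
split.
- intros H eps Heps; apply at_right_0_iff.
  apply (H (fun v => norm (minus v y) < eps)), locally_norm_iff; exists eps; auto.
- intros H P HP; apply locally_norm_iff in HP; destruct HP as (e & He & HP).
  apply at_right_0_iff; destruct (H e He) as (d & Hd & Hh); exists d; split; auto.
Qed.

(** The difference quotient estimate with its denominator cleared, so that such estimates add up
    without divisions. *)
Definition right_derivative_at_0 (f : R -> X) x y : Prop :=
  forall eps, 0 < eps -> exists d, 0 < d /\ forall h, 0 < h < d ->
    norm (minus (minus (f h) x) (rscal h y)) <= eps * h.

Lemma generator_iff T x y :
  graph (generator T) x y <-> right_derivative_at_0 (fun h => T h x) x y.
Proof.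
simpl; unfold generator_graph; rewrite filterlim_at_right_0_iff.
split; intros H eps Heps.
- destruct (H eps Heps) as (d & Hd & Hh); exists d; split; [exact Hd|]; intros h Hh0.
  specialize (Hh h Hh0).
  change (norm (minus (rscal (/ h) (minus (T h x) x)) y) < eps) in Hh.
  replace (minus (minus (T h x) x) (rscal h y))
    with (rscal h (minus (rscal (/ h) (minus (T h x) x)) y)) by (vec_field; lra).
  eapply Rle_trans; [apply norm_rscal_nonneg; lra|]; nra.
- destruct (H (eps / 2) ltac:(lra)) as (d & Hd & Hh); exists d; split; [exact Hd|].
  intros h Hh0; specialize (Hh h Hh0).
  change (norm (minus (rscal (/ h) (minus (T h x) x)) y) < eps).
  replace (minus (rscal (/ h) (minus (T h x) x)) y)
    with (rscal (/ h) (minus (minus (T h x) x) (rscal h y))) by (vec_field; lra).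
  assert (Hi : 0 < / h) by (apply Rinv_0_lt_compat; lra).
  eapply Rle_lt_trans; [apply norm_rscal_nonneg; lra|].
  apply Rle_lt_trans with (/ h * (eps / 2 * h)); [apply Rmult_le_compat_l; lra|].
  replace (/ h * (eps / 2 * h)) with (eps / 2) by (field; lra); lra.
Qed.

Lemma semigroup_add T t x y : 0 <= t -> T t (plus x y) = plus (T t x) (T t y).
Proof. intros Ht; exact (linear_plus _ (semigroup_linear T t Ht) x y). Qed.

Lemma semigroup_scal T t (k : C) x : 0 <= t ->
  T t (scal (k : C_AbsRing) x) = scal (k : C_AbsRing) (T t x).
Proof. intros Ht; exact (linear_scal _ (semigroup_linear T t Ht) (k : C_AbsRing) x). Qed.

Lemma semigroup_rscal T t r x : 0 <= t -> T t (rscal r x) = rscal r (T t x).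
Proof. intros Ht; now apply semigroup_scal. Qed.

Lemma semigroup_zero T t : 0 <= t -> T t zero = zero.
Proof.
intros Ht; replace (zero : X) with (rscal 0 (zero : X)) at 1 by vec.
rewrite semigroup_rscal by exact Ht; vec.
Qed.

Lemma semigroup_minus T t x y : 0 <= t -> T t (minus x y) = minus (T t x) (T t y).
Proof.
intros Ht; replace (minus x y) with (plus x (rscal (-1) y)) by vec.
rewrite semigroup_add, semigroup_rscal by exact Ht; vec.
Qed.

Lemma semigroup_commute T s t x : 0 <= s -> 0 <= t -> T s (T t x) = T t (T s x).
Proof.
intros Hs Ht; rewrite <- !semigroup_plus by assumption; f_equal; apply Rplus_comm.
Qed.

Lemma semigroup_bounded T t : 0 <= t ->
  exists M, 0 < M /\ forall x, norm (T t x) <= M * norm x.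
Proof.
intros Ht; destruct (linear_norm _ (semigroup_linear T t Ht)) as (M & HM & H).
exists M; split; [exact HM|exact H].
Qed.

Lemma semigroup_right_continuous T x eps : 0 < eps ->
  exists d, 0 < d /\ forall h, 0 <= h < d -> norm (minus (T h x) x) < eps.
Proof.
intros Heps.
destruct (proj1 (filterlim_at_right_0_iff _ _) (semigroup_continuous T x) eps Heps)
  as (d & Hd & H).
exists d; split; [exact Hd|]; intros h Hh.
destruct (Req_dec h 0) as [->|Hn]; [|apply H; lra].
rewrite semigroup_0; replace (minus x x) with (zero : X) by vec.
rewrite norm_zero_eq; exact Heps.
Qed.

(** Uniform boundedness through Baire's theorem. Continuity at 0 bounds an orbit only on an interval
    depending on the point, so the index [k] measures the bound and the length [1 / (k + 1)] of the
    interval at once. *)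
Lemma semigroup_bounded_near_0 T :
  exists d M, 0 < d /\ 1 <= M /\ forall h, 0 <= h <= d -> forall x, norm (T h x) <= M * norm x.
Proof.
destruct (baire (fun _ : X => True)
   (fun k x => forall h, 0 <= h <= / (INR k + 1) -> norm (T h x) <= INR k))
  as (k & x0 & r & _ & Hr & Hdense).
{ intros x _; exact I. }
{ exists zero; exact I. }
{ intros x _; destruct (semigroup_right_continuous T x 1 Rlt_0_1) as (d & Hd & Hh).
  assert (Hi : 0 < / d) by now apply Rinv_0_lt_compat.
  pose proof (norm_nonneg x) as Hx.
  destruct (nfloor_ex (norm x + 1 + / d) ltac:(lra)) as (k & _ & Hk).
  exists (S k); intros h Hh0; rewrite S_INR in *.
  assert (Hhd : h < d).
  { eapply Rle_lt_trans; [apply Hh0|]; rewrite <- (Rinv_inv d).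
    apply Rinv_lt_contravar; [apply Rmult_lt_0_compat; lra|lra]. }
  specialize (Hh h ltac:(lra)); pose proof (norm_le_minus (T h x) x); lra. }
assert (Hk0 : 0 < INR k + 1) by (pose proof (pos_INR k); lra).
(* Each single [T h] is bounded, so the bound passes from the dense subset to the whole ball. *)
assert (Hball : forall x h, norm (minus x x0) < r -> 0 <= h <= / (INR k + 1) ->
   norm (T h x) <= INR k).
{ intros x h Hx Hh; destruct (semigroup_bounded T h ltac:(lra)) as (M & HM & HTM).
  apply (le_epsilon_scaled _ _ M); [lra|]; intros eps Heps.
  destruct (Hdense x I Hx eps Heps) as (u & _ & Hu & Hxu).
  specialize (Hu h Hh); pose proof (norm_le_minus (T h x) (T h u)) as H1.
  rewrite <- semigroup_minus in H1 by lra; specialize (HTM (minus x u)).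
  assert (M * norm (minus x u) <= M * eps) by (apply Rmult_le_compat_l; lra); lra. }
(* A rescaled difference of two points of the ball gives [4 * INR k / r], as in the open mapping
   theorem; adding 1 makes the constant at least 1, so that its powers increase. *)
exists (/ (INR k + 1)), (4 * INR k / r + 1).
assert (HM : 0 <= 4 * INR k / r).
{ apply Rmult_le_pos; [pose proof (pos_INR k); lra|apply Rlt_le, Rinv_0_lt_compat, Hr]. }
split; [now apply Rinv_0_lt_compat|split; [lra|]].
intros h Hh x; destruct (Req_dec (norm x) 0) as [H0|Hn].
{ destruct (semigroup_bounded T h ltac:(lra)) as (M & _ & H).
  specialize (H x); rewrite H0 in *; lra. }
assert (Hx : 0 < norm x) by (pose proof (norm_nonneg x); lra).
set (c := 2 * norm x / r).
assert (Hc : 0 < c) by (apply Rdiv_lt_0_compat; lra).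
set (x1 := rscal (/ c) x).
assert (Hx1 : norm x1 <= r / 2).
{ eapply Rle_trans; [apply norm_rscal_nonneg; apply Rlt_le, Rinv_0_lt_compat, Hc|].
  unfold c; apply Req_le; field; lra. }
assert (H1 : norm (T h (plus x0 x1)) <= INR k).
{ apply Hball; [|exact Hh]; replace (minus (plus x0 x1) x0) with x1 by vec; lra. }
assert (H2 : norm (T h x0) <= INR k).
{ apply Hball; [|exact Hh]; replace (minus x0 x0) with (zero : X) by vec.
  rewrite norm_zero_eq; lra. }
replace x with (rscal c (minus (plus x0 x1) x0)) at 1 by (unfold x1; vec_field; lra).
rewrite semigroup_rscal, semigroup_minus by lra.
eapply Rle_trans; [apply norm_rscal_nonneg; lra|].
pose proof (norm_minus_le (T h (plus x0 x1)) (T h x0)).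
apply Rle_trans with (c * (2 * INR k)); [apply Rmult_le_compat_l; lra|].
unfold c; apply Rle_trans with (4 * INR k / r * norm x); [apply Req_le; field; lra|nra].
Qed.

Lemma semigroup_locally_bounded T t :
  exists M, 1 <= M /\ forall s, 0 <= s <= t -> forall x, norm (T s x) <= M * norm x.
Proof.
destruct (semigroup_bounded_near_0 T) as (d & M & Hd & HM & H).
assert (Hn : forall n s, 0 <= s <= INR n * d -> forall x, norm (T s x) <= M ^ n * norm x).
{ induction n as [|n IH]; intros s Hs x.
  - simpl in Hs; replace s with 0 by lra; rewrite semigroup_0; simpl; lra.
  - rewrite S_INR in Hs; pose proof (pow_R1_Rle M n HM) as Hp; pose proof (norm_nonneg x).
    cbn [pow]; destruct (Rle_dec s d) as [Hsd|Hsd].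
    + specialize (H s ltac:(lra) x); assert (0 <= M * norm x) by (apply Rmult_le_pos; lra).
      nra.
    + replace s with (d + (s - d)) by ring; rewrite semigroup_plus by lra.
      specialize (IH (s - d) ltac:(lra) x); specialize (H d ltac:(lra) (T (s - d) x)).
      apply (Rmult_le_compat_l M) in IH; lra. }
destruct (nfloor_ex (Rabs t / d)) as (n & _ & Hn1).
{ apply Rmult_le_pos; [apply Rabs_pos|apply Rlt_le, Rinv_0_lt_compat, Hd]. }
exists (M ^ S n); split; [now apply pow_R1_Rle|].
intros s Hs; apply Hn; split; [lra|]; rewrite S_INR.
apply (Rmult_lt_compat_r d) in Hn1; [|exact Hd].
replace (Rabs t / d * d) with (Rabs t) in Hn1 by (field; lra).
pose proof (Rle_abs t); lra.
Qed.

(** * Riemann sums along orbits and closedness of the generator *)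

(** [h] times this sum is the left Riemann sum of the orbit of [z] on the interval from 0 to
    [n h]. *)
Fixpoint orbit_sum T (h : R) (n : nat) z : X :=
  match n with
  | O => zero
  | S k => plus (orbit_sum T h k z) (T (INR k * h) z)
  end.

Lemma INR_mult_nonneg n h : 0 <= h -> 0 <= INR n * h.
Proof. intros Hh; apply Rmult_le_pos; [apply pos_INR|exact Hh]. Qed.

Lemma orbit_sum_telescope T h n u v : 0 <= h -> T h u = plus u v ->
  T (INR n * h) u = plus u (orbit_sum T h n v).
Proof.
intros Hh Huv; induction n as [|n IH].
- simpl; rewrite Rmult_0_l, semigroup_0; vec.
- rewrite S_INR; replace ((INR n + 1) * h) with (INR n * h + h) by ring.
  rewrite semigroup_plus, Huv, semigroup_add, IH by (auto using INR_mult_nonneg).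
  simpl; vec.
Qed.

(** The discrete fundamental theorem of calculus: applying [T h] shifts the sum by one term, so only
    the end terms survive. *)
Lemma orbit_sum_diff T h n z : 0 <= h ->
  T h (orbit_sum T h n z) = plus (orbit_sum T h n z) (minus (T (INR n * h) z) z).
Proof.
intros Hh; induction n as [|n IH].
- simpl; rewrite semigroup_zero, Rmult_0_l, semigroup_0 by exact Hh; vec.
- cbn [orbit_sum]; rewrite semigroup_add, IH, <- semigroup_plus by (auto using INR_mult_nonneg).
  rewrite S_INR; replace ((INR n + 1) * h) with (h + INR n * h) by ring; vec.
Qed.

Lemma orbit_sum_near T h n z eta : 0 <= h ->
  (forall s, 0 <= s <= INR n * h -> norm (minus (T s z) z) <= eta) ->
  norm (minus (orbit_sum T h n z) (rscal (INR n) z)) <= INR n * eta.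
Proof.
intros Hh; induction n as [|n IH]; intros H.
- simpl; replace (minus (zero : X) (rscal 0 z)) with (zero : X) by vec; rewrite norm_zero_eq; lra.
- rewrite S_INR in *; cbn [orbit_sum].
  pose proof (INR_mult_nonneg n h Hh).
  replace (minus (plus (orbit_sum T h n z) (T (INR n * h) z)) (rscal (INR n + 1) z))
    with (plus (minus (orbit_sum T h n z) (rscal (INR n) z)) (minus (T (INR n * h) z) z))
    by vec.
  eapply Rle_trans; [apply norm_plus_le|].
  assert (norm (minus (orbit_sum T h n z) (rscal (INR n) z)) <= INR n * eta)
    by (apply IH; intros s Hs; apply H; lra).
  pose proof (H (INR n * h) ltac:(lra)); lra.
Qed.

Lemma orbit_sum_norm T h n z M : 0 <= h ->
  (forall s, 0 <= s <= INR n * h -> norm (T s z) <= M) ->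
  norm (orbit_sum T h n z) <= INR n * M.
Proof.
intros Hh; induction n as [|n IH]; intros H.
- simpl; rewrite norm_zero_eq; lra.
- rewrite S_INR in *; cbn [orbit_sum]; pose proof (INR_mult_nonneg n h Hh).
  eapply Rle_trans; [apply norm_plus_le|].
  assert (norm (orbit_sum T h n z) <= INR n * M) by (apply IH; intros s Hs; apply H; lra).
  pose proof (H (INR n * h) ltac:(lra)); lra.
Qed.

Lemma orbit_sum_add T h a b z : 0 <= h ->
  orbit_sum T h (a + b) z = plus (orbit_sum T h a z) (T (INR a * h) (orbit_sum T h b z)).
Proof.
intros Hh; induction b as [|b IH].
- rewrite Nat.add_0_r; simpl; rewrite semigroup_zero by (now apply INR_mult_nonneg); vec.
- rewrite Nat.add_succ_r; cbn [orbit_sum].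
  rewrite IH, semigroup_add, <- semigroup_plus by (auto using INR_mult_nonneg).
  rewrite plus_INR; replace ((INR a + INR b) * h) with (INR a * h + INR b * h) by ring; vec.
Qed.

(** Grouping the terms into blocks of length [l] compares a Riemann sum with its refinement. *)
Lemma orbit_sum_mul T h n l z : 0 <= h ->
  orbit_sum T h (n * l) z = orbit_sum T (INR l * h) n (orbit_sum T h l z).
Proof.
intros Hh; induction n as [|n IH]; [reflexivity|].
replace (S n * l)%nat with (n * l + l)%nat by lia.
rewrite orbit_sum_add, IH by exact Hh; cbn [orbit_sum].
rewrite mult_INR, Rmult_assoc; reflexivity.
Qed.

Lemma orbit_sum_minus T h n u v : 0 <= h ->
  orbit_sum T h n (minus u v) = minus (orbit_sum T h n u) (orbit_sum T h n v).
Proof.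
intros Hh; induction n as [|n IH]; cbn [orbit_sum]; [vec|].
rewrite IH, semigroup_minus by (now apply INR_mult_nonneg); vec.
Qed.

Lemma orbit_sum_rscal T h n r u : 0 <= h ->
  orbit_sum T h n (rscal r u) = rscal r (orbit_sum T h n u).
Proof.
intros Hh; induction n as [|n IH]; cbn [orbit_sum]; [vec|].
rewrite IH, semigroup_rscal by (now apply INR_mult_nonneg); vec.
Qed.

(* A limit, as [h] tends to 0, of points of the graphs of the difference
   quotients (T(h) - I)/h lies in the graph of the generator; this yields the
   closedness of the generator and replaces integration along orbits. *)
Definition quotient_limit T x y : Prop :=
  forall eps, 0 < eps -> exists (h : R) (u v : X),
    0 < h < eps /\ norm (minus u x) < eps /\ norm (minus v y) < eps /\
    T h u = plus u (rscal h v).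

(** For a generator pair this bounds the integral of [T s y - y] over [0, t]. With [t = j h + r] and
    [0 <= r < h], the approximating pair telescopes exactly over [j] steps, and right continuity at
    0 handles the rest [r]. *)
Lemma quotient_limit_estimate T x y t eta : quotient_limit T x y -> 0 <= t ->
  (forall s, 0 <= s <= t -> norm (minus (T s y) y) <= eta) ->
  norm (minus (minus (T t x) x) (rscal t y)) <= t * eta.
Proof.
intros Hq Ht Heta.
destruct (semigroup_locally_bounded T t) as (M & HM & HTM).
pose proof (norm_nonneg y) as Hy.
(* One summand per error term in the decomposition below, in this order: [T r x - x], [x - u],
   [u - x], [r y], [v - y], and [T s v - v] against [T s y - y]. *)
apply (le_epsilon_scaled _ _ (M + M + 1 + norm y + t + t * (M + 1)));
  [assert (0 <= t * (M + 1)) by (apply Rmult_le_pos; lra); lra|].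
intros eps Heps.
destruct (semigroup_right_continuous T x eps Heps) as (d & Hd & Hcont).
destruct (Hq (Rmin eps d) (Rmin_pos _ _ Heps Hd)) as (h & u & v & Hh & Hu & Hv & Huv).
pose proof (Rmin_l eps d); pose proof (Rmin_r eps d).
destruct (nfloor_ex (t / h)) as (j & Hj1 & Hj2).
{ apply Rmult_le_pos; [exact Ht|apply Rlt_le, Rinv_0_lt_compat; lra]. }
assert (Hth : t / h * h = t) by (field; lra).
apply (Rmult_le_compat_r h) in Hj1; [|lra].
apply (Rmult_lt_compat_r h) in Hj2; [|lra].
rewrite Hth in Hj1, Hj2; rewrite Rmult_plus_distr_r, Rmult_1_l in Hj2.
pose proof (INR_mult_nonneg j h ltac:(lra)) as Hjh.
set (a := INR j * h) in *; set (r := t - a).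
assert (HT : T t x = plus (T a (minus (T r x) x)) (plus (T a (minus x u)) (T a u))).
{ replace t with (a + r) at 1 by (unfold r; ring).
  rewrite !semigroup_minus, <- semigroup_plus by (unfold r; lra); vec. }
rewrite HT; unfold a at 3.
rewrite (orbit_sum_telescope T h j u (rscal h v)), orbit_sum_rscal by (auto; lra).
replace (minus (minus (plus (T a (minus (T r x) x))
      (plus (T a (minus x u)) (plus u (rscal h (orbit_sum T h j v))))) x) (rscal t y))
  with (plus (plus (T a (minus (T r x) x)) (T a (minus x u)))
       (plus (minus u x)
         (plus (rscal h (minus (orbit_sum T h j v) (rscal (INR j) v)))
             (minus (rscal a (minus v y)) (rscal r y)))))
  by (unfold r, a; vec).
assert (H1 : norm (T a (minus (T r x) x)) <= M * eps).
{ eapply Rle_trans; [apply HTM; lra|]; apply Rmult_le_compat_l; [lra|].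
  apply Rlt_le, Hcont; unfold r; lra. }
assert (H2 : norm (T a (minus x u)) <= M * eps).
{ eapply Rle_trans; [apply HTM; lra|]; apply Rmult_le_compat_l; [lra|].
  rewrite norm_minus_sym; lra. }
assert (H3 : norm (rscal h (minus (orbit_sum T h j v) (rscal (INR j) v)))
   <= a * (eta + (M + 1) * eps)).
{ eapply Rle_trans; [apply norm_rscal_nonneg; lra|].
  apply Rle_trans with (h * (INR j * (eta + (M + 1) * eps)));
    [|apply Req_le; unfold a; ring].
  apply Rmult_le_compat_l; [lra|]; apply orbit_sum_near; [lra|]; intros s Hs.
  fold a in Hs.
  replace (minus (T s v) v) with
    (plus (T s (minus v y)) (plus (minus (T s y) y) (minus y v)))
    by (rewrite semigroup_minus by lra; vec).
  eapply Rle_trans; [apply norm_plus_le|].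
  pose proof (norm_plus_le (minus (T s y) y) (minus y v)) as H4.
  rewrite (norm_minus_sym y v) in H4.
  pose proof (HTM s ltac:(lra) (minus v y)) as H5.
  assert (M * norm (minus v y) <= M * eps) by (apply Rmult_le_compat_l; lra).
  specialize (Heta s ltac:(lra)); lra. }
assert (H4 : norm (rscal a (minus v y)) <= t * eps).
{ eapply Rle_trans; [now apply norm_rscal_nonneg|].
  pose proof (norm_nonneg (minus v y)); apply Rmult_le_compat; lra. }
assert (H5 : norm (rscal r y) <= norm y * eps).
{ eapply Rle_trans; [apply norm_rscal_nonneg; unfold r; lra|].
  rewrite Rmult_comm; apply Rmult_le_compat_l; unfold r; lra. }
assert (H6 : a * (eta + (M + 1) * eps) <= t * eta + t * (M + 1) * eps).
{ assert (0 <= eta).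
  { eapply Rle_trans; [|apply (Heta 0); lra]; apply norm_nonneg. }
  apply Rle_trans with (t * (eta + (M + 1) * eps)); [|lra].
  apply Rmult_le_compat_r; [|lra].
  apply Rplus_le_le_0_compat; [lra|apply Rmult_le_pos; lra]. }
eapply Rle_trans; [apply norm_plus_le|].
pose proof (norm_plus_le (T a (minus (T r x) x)) (T a (minus x u))).
match goal with |- context [norm (plus (minus u x) ?b)] =>
  pose proof (norm_plus_le (minus u x) b) end.
match goal with H : context [norm (plus (rscal h ?c) ?b)] |- _ =>
  pose proof (norm_plus_le (rscal h c) b) end.
pose proof (norm_minus_le (rscal a (minus v y)) (rscal r y)).
lra.
Qed.

Lemma quotient_limit_generator T x y : quotient_limit T x y -> graph (generator T) x y.
Proof.
intros Hq; apply generator_iff; intros eps Heps.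
destruct (semigroup_right_continuous T y eps Heps) as (d & Hd & H).
exists d; split; [exact Hd|]; intros h Hh; rewrite Rmult_comm.
apply quotient_limit_estimate; [exact Hq|lra|].
intros s Hs; apply Rlt_le, H; lra.
Qed.

Lemma generator_quotient_limit T x y : graph (generator T) x y -> quotient_limit T x y.
Proof.
intros H eps Heps; rewrite generator_iff in H.
destruct (H (eps / 2) ltac:(lra)) as (d & Hd & Hh).
set (h := Rmin eps d / 2).
assert (Hm : 0 < Rmin eps d) by now apply Rmin_pos.
pose proof (Rmin_l eps d); pose proof (Rmin_r eps d).
exists h, x, (rscal (/ h) (minus (T h x) x)); repeat split.
- unfold h; lra.
- unfold h; lra.
- replace (minus x x) with (zero : X) by vec; rewrite norm_zero_eq; exact Heps.
- assert (Hh0 : 0 < h) by (unfold h; lra).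
  replace (minus (rscal (/ h) (minus (T h x) x)) y)
    with (rscal (/ h) (minus (minus (T h x) x) (rscal h y))) by (vec_field; lra).
  assert (Hi : 0 < / h) by now apply Rinv_0_lt_compat.
  eapply Rle_lt_trans; [apply norm_rscal_nonneg; lra|].
  specialize (Hh h ltac:(unfold h; lra)).
  apply Rle_lt_trans with (/ h * (eps / 2 * h)); [apply Rmult_le_compat_l; lra|].
  replace (/ h * (eps / 2 * h)) with (eps / 2) by (field; lra); lra.
- vec_field; unfold h; lra.
Qed.

(** Quotient limits are stable under limits, since each of them may be replaced by one of its
    approximating pairs; hence so is the graph of the generator. *)
Lemma generator_closed T : closed_relation (graph (generator T)).
Proof.
split.
- exact (graph_zero (generator T)).
- intros x y x' y'; exact (graph_plus (generator T)).
- intros k x y; exact (graph_scal (generator T) k).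
- intros x y H; apply quotient_limit_generator; intros eps Heps.
  destruct (H (eps / 2) ltac:(lra)) as (x' & y' & HG & Hx & Hy).
  destruct (generator_quotient_limit T x' y' HG (eps / 2) ltac:(lra))
    as (h & u & v & Hh & Hu & Hv & Huv).
  exists h, u, v; repeat split; try lra; try exact Huv.
  + pose proof (norm_minus_trans u x' x); lra.
  + pose proof (norm_minus_trans v y' y); lra.
Qed.

Lemma generator_orbit_affine T x y t : graph (generator T) x y ->
  (forall s, 0 <= s -> T s y = y) -> 0 <= t -> T t x = plus x (rscal t y).
Proof.
intros H Hy Ht.
apply (norm_small_eq 1); [lra|]; intros eps Heps.
replace (minus (T t x) (plus x (rscal t y))) with (minus (minus (T t x) x) (rscal t y)) by vec.
(* The orbit of [y] is constant, so the estimate holds with [eta = 0]. *)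
apply Rle_trans with (t * 0); [|lra].
apply quotient_limit_estimate; [now apply generator_quotient_limit|exact Ht|].
intros s Hs; rewrite Hy by lra; replace (minus y y) with (zero : X) by vec.
rewrite norm_zero_eq; lra.
Qed.

Lemma generator_kernel_fixed T y t : graph (generator T) y zero -> 0 <= t -> T t y = y.
Proof.
intros H Ht; rewrite (generator_orbit_affine T y zero t H); [vec| |exact Ht].
intros s Hs; now apply semigroup_zero.
Qed.

Lemma generator_commute T x y t : 0 <= t ->
  graph (generator T) x y -> graph (generator T) (T t x) (T t y).
Proof.
intros Ht H; apply quotient_limit_generator; intros eps Heps.
destruct (semigroup_bounded T t Ht) as (M & HM & HTM).
assert (He : 0 < Rmin eps (eps / M)) by (apply Rmin_pos; [lra|now apply Rdiv_lt_0_compat]).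
pose proof (Rmin_l eps (eps / M)); pose proof (Rmin_r eps (eps / M)) as Hr.
destruct (generator_quotient_limit T x y H _ He) as (h & u & v & Hh & Hu & Hv & Huv).
apply (Rmult_le_compat_l M) in Hr; [|lra].
replace (M * (eps / M)) with eps in Hr by (field; lra).
exists h, (T t u), (T t v); rewrite <- !semigroup_minus by exact Ht; repeat split; try lra.
- eapply Rle_lt_trans; [apply HTM|]; nra.
- eapply Rle_lt_trans; [apply HTM|]; nra.
- rewrite (semigroup_commute T h t), Huv, semigroup_add, semigroup_rscal by lra; reflexivity.
Qed.

(** [w] is the integral of the orbit of [z] over [0, t], a limit of Riemann sums. Against a
    refinement, the difference on each block is some [T s] applied to an oscillation of the orbit
    near 0, which [M] keeps uniformly small; so the sums are Cauchy. *)
Lemma generator_orbit_average T t z M : 0 < t ->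
  (forall s x, 0 <= s <= t -> norm (T s x) <= M * norm x) ->
  exists w, graph (generator T) w (minus (T t z) z) /\ norm w <= t * M * norm z.
Proof.
intros Ht HM.
set (w := fun n => rscal (t / INR (S n)) (orbit_sum T (t / INR (S n)) (S n) z)).
assert (HI : forall n, 0 < INR (S n)) by (intros n; apply lt_0_INR; lia).
(* Index [n] stands for [S n] subintervals, so index [n + l * S n] stands for [S n * S l] of them, a
   refinement. *)
assert (Hrefine : forall n l eta,
   (forall s, 0 <= s <= t / INR (S n) -> norm (minus (T s z) z) <= eta) ->
   norm (minus (w (n + l * S n)%nat) (w n)) <= t * (Rabs M * eta)).
{ intros n l eta Heta; unfold w.
  replace (S (n + l * S n)) with (S n * S l)%nat by lia.
  pose proof (HI n) as HN; pose proof (HI l) as HL.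
  set (N := S n) in *; set (L := S l) in *; clearbody N L; set (h := t / INR N) in *.
  rewrite mult_INR.
  assert (Hh : 0 < h) by (now apply Rdiv_lt_0_compat).
  assert (HhL : 0 < h / INR L) by (now apply Rdiv_lt_0_compat).
  replace (t / (INR N * INR L)) with (h / INR L) by (unfold h; field; lra).
  rewrite orbit_sum_mul by lra.
  replace (INR L * (h / INR L)) with h by (field; lra).
  set (q := orbit_sum T (h / INR L) L z).
  replace (minus (rscal (h / INR L) (orbit_sum T h N q)) (rscal h (orbit_sum T h N z)))
    with (rscal h (orbit_sum T h N (minus (rscal (/ INR L) q) z)))
    by (rewrite orbit_sum_minus, orbit_sum_rscal by lra; vec_field; lra).
  eapply Rle_trans; [apply norm_rscal_nonneg; lra|].
  replace (t * (Rabs M * eta)) with (h * (INR N * (Rabs M * eta)))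
    by (unfold h; field; lra).
  apply Rmult_le_compat_l; [lra|]; apply orbit_sum_norm; [lra|].
  intros s Hs; replace (INR N * h) with t in Hs by (unfold h; field; lra).
  eapply Rle_trans; [now apply HM|].
  apply Rle_trans with (Rabs M * norm (minus (rscal (/ INR L) q) z)).
  { apply Rmult_le_compat_r; [apply norm_nonneg|apply Rle_abs]. }
  apply Rmult_le_compat_l; [apply Rabs_pos|].
  replace (minus (rscal (/ INR L) q) z)
    with (rscal (/ INR L) (minus q (rscal (INR L) z))) by (vec_field; lra).
  assert (0 < / INR L) by now apply Rinv_0_lt_compat.
  eapply Rle_trans; [apply norm_rscal_nonneg; lra|].
  apply Rle_trans with (/ INR L * (INR L * eta)); [|apply Req_le; field; lra].
  apply Rmult_le_compat_l; [lra|]; apply orbit_sum_near; [lra|].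
  intros s' Hs'; apply Heta.
  replace (INR L * (h / INR L)) with h in Hs' by (field; lra); exact Hs'. }
assert (Hmesh : forall d, 0 < d -> exists N, forall n, (N <= n)%nat -> t / INR (S n) < d).
{ intros d Hd; destruct (nfloor_ex (t / d)) as (N & _ & HN).
  { apply Rlt_le, Rdiv_lt_0_compat; lra. }
  exists N; intros n Hn; specialize (HI n).
  apply (Rmult_lt_compat_r d) in HN; [|exact Hd].
  replace (t / d * d) with t in HN by (field; lra).
  apply (Rmult_lt_reg_r (INR (S n))); [exact HI|].
  replace (t / INR (S n) * INR (S n)) with t by (field; lra).
  apply le_INR in Hn; rewrite S_INR; nra. }
destruct (cauchy_tends_to w) as [x Hx].
{ intros eps Heps.
  pose proof (Rabs_pos M) as HMp.
  assert (Hp : 0 < t * Rabs M * 2 + 1).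
  { assert (0 <= t * Rabs M) by (apply Rmult_le_pos; lra); lra. }
  set (eta := eps / (t * Rabs M * 2 + 1)).
  assert (Heta : 0 < eta) by now apply Rdiv_lt_0_compat.
  destruct (semigroup_right_continuous T z eta Heta) as (d & Hd & Hcont).
  destruct (Hmesh d Hd) as [N HN]; exists N; intros n m Hn Hm.
  assert (Hn' := Hrefine n m eta ltac:(intros s Hs; apply Rlt_le, Hcont; specialize (HN n Hn); lra)).
  assert (Hm' := Hrefine m n eta ltac:(intros s Hs; apply Rlt_le, Hcont; specialize (HN m Hm); lra)).
  (* Both indices denote the common refinement of the two partitions. *)
  replace (m + n * S m)%nat with (n + m * S n)%nat in Hm' by lia.
  pose proof (norm_minus_trans (w n) (w (n + m * S n)%nat) (w m)) as H.
  rewrite (norm_minus_sym (w n) (w (n + m * S n)%nat)) in H.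
  assert (eta * (t * Rabs M * 2 + 1) = eps) by (unfold eta; field; lra).
  lra. }
exists x; split.
(* The difference quotient of each Riemann sum at its own mesh equals [T t z - z], so the second
   component of the approximating pairs is constant. *)
- apply quotient_limit_generator; intros eps Heps.
  destruct (Hx eps Heps) as [N HN]; destruct (Hmesh eps Heps) as [N' HN'].
  set (n := (N + N')%nat); specialize (HN n ltac:(lia)); specialize (HN' n ltac:(lia)).
  pose proof (HI n) as Hn; set (h := t / INR (S n)) in *.
  assert (Hh : 0 < h) by now apply Rdiv_lt_0_compat.
  exists h, (w n), (minus (T t z) z); repeat split; auto.
  + replace (minus (minus (T t z) z) (minus (T t z) z)) with (zero : X) by vec.
    rewrite norm_zero_eq; exact Heps.
  + unfold w; fold h; rewrite semigroup_rscal, orbit_sum_diff by lra.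
    replace (INR (S n) * h) with t by (unfold h; field; lra); vec.
- replace x with (minus x (zero : X)) by vec.
  apply (tends_to_norm_le w x (zero : X) _ O Hx); intros n _.
  replace (minus (w n) (zero : X)) with (w n) by vec; unfold w.
  pose proof (HI n) as Hn.
  assert (Hh : 0 < t / INR (S n)) by now apply Rdiv_lt_0_compat.
  eapply Rle_trans; [apply norm_rscal_nonneg; lra|].
  apply Rle_trans with (t / INR (S n) * (INR (S n) * (M * norm z)));
    [|apply Req_le; field; lra].
  apply Rmult_le_compat_l; [lra|]; apply orbit_sum_norm; [lra|].
  intros s Hs; replace (INR (S n) * (t / INR (S n))) with t in Hs by (field; lra).
  now apply HM.
Qed.

End Semigroup.

(** * Exponential rescaling and the resolvent *)

Lemma exp_linear_right_derivative (c eps : R) : 0 < eps ->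
  exists d, 0 < d /\ forall h, 0 < h < d -> Rabs (exp (c * h) - 1 - c * h) <= eps * h.
Proof.
intros Heps.
assert (H : is_derive (fun h => exp (c * h)) 0 c).
{ auto_derive; [exact I|]; rewrite Rmult_0_r, exp_0; ring. }
apply is_derive_Reals in H; destruct (H eps Heps) as [d Hd].
exists d; split; [apply cond_pos|]; intros h Hh.
specialize (Hd h ltac:(lra) ltac:(rewrite Rabs_pos_eq; lra)).
rewrite Rplus_0_l, Rmult_0_r, exp_0 in Hd.
replace (exp (c * h) - 1 - c * h) with (((exp (c * h) - 1) / h - c) * h) by (field; lra).
rewrite Rabs_mult, (Rabs_pos_eq h) by lra; apply Rmult_le_compat_r; lra.
Qed.

Lemma exp_linear_right_continuous (c eps : R) : 0 < eps ->
  exists d, 0 < d /\ forall h, 0 < h < d -> Rabs (exp (c * h) - 1) <= eps.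
Proof.
intros Heps; destruct (exp_linear_right_derivative c 1 Rlt_0_1) as (d & Hd & H).
assert (Hc : 0 < Rabs c + 1) by (pose proof (Rabs_pos c); lra).
exists (Rmin d (eps / (Rabs c + 1))); split.
{ apply Rmin_pos; [exact Hd|now apply Rdiv_lt_0_compat]. }
intros h Hh; pose proof (Rmin_l d (eps / (Rabs c + 1))).
pose proof (Rmin_r d (eps / (Rabs c + 1))).
specialize (H h ltac:(lra)).
assert (h * (Rabs c + 1) <= eps).
{ apply Rle_trans with (eps / (Rabs c + 1) * (Rabs c + 1));
    [apply Rmult_le_compat_r; lra|apply Req_le; field; lra]. }
replace (exp (c * h) - 1) with (exp (c * h) - 1 - c * h + c * h) by ring.
eapply Rle_trans; [apply Rabs_triang|]; rewrite (Rabs_mult c), (Rabs_pos_eq h) by lra; lra.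
Qed.

Lemma exp_mult_INR (n : nat) (x : R) : exp (INR n * x) = exp x ^ n.
Proof.
induction n as [|n IH].
- simpl; rewrite Rmult_0_l; apply exp_0.
- rewrite S_INR, Rmult_plus_distr_r, Rmult_1_l, exp_plus, IH; simpl; ring.
Qed.

(** The bound [1 + y <= exp y] at [y = x / (n + 1)], raised to the power [n + 1]. The power beyond
    [n] is what lets the exponential dominate [t ^ n]. *)
Lemma exp_ge_pow (n : nat) (x : R) : 0 <= x -> (x / INR (S n)) ^ S n <= exp x.
Proof.
intros Hx; assert (Hn : 0 < INR (S n)) by (apply lt_0_INR; lia).
replace x with (INR (S n) * (x / INR (S n))) at 2 by (field; lra).
rewrite exp_mult_INR; apply pow_incr; split.
- apply Rmult_le_pos; [exact Hx|apply Rlt_le, Rinv_0_lt_compat, Hn].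
- pose proof (exp_ineq1_le (x / INR (S n))); lra.
Qed.

Section Growth.
Context {X : CompleteNormedModule C_AbsRing}.
Implicit Types (x y z w : X) (T : C0_semigroup X).

Lemma right_derivative_exp (f : R -> X) x y (c : R) : right_derivative_at_0 f x y ->
  right_derivative_at_0 (fun h => rscal (exp (c * h)) (f h)) x (plus y (rscal c x)).
Proof.
intros H eps Heps.
pose proof (norm_nonneg x) as Hx; pose proof (norm_nonneg y) as Hy.
(* The three error terms of the product rule carry the factors 2 (from [exp (c * h) <= 2]), [norm x]
   and [norm y]. *)
set (q := 2 + norm x + norm y).
assert (He : 0 < eps / q) by (apply Rdiv_lt_0_compat; unfold q; lra).
destruct (H _ He) as (d1 & Hd1 & H1).
destruct (exp_linear_right_derivative c _ He) as (d2 & Hd2 & H2).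
destruct (exp_linear_right_continuous c _ He) as (d3 & Hd3 & H3).
destruct (exp_linear_right_continuous c _ Rlt_0_1) as (d4 & Hd4 & H4).
exists (Rmin (Rmin d1 d2) (Rmin d3 d4)); split; [repeat apply Rmin_pos; assumption|].
intros h Hh.
assert (h < d1 /\ h < d2 /\ h < d3 /\ h < d4) as (? & ? & ? & ?).
{ pose proof (Rmin_l (Rmin d1 d2) (Rmin d3 d4)); pose proof (Rmin_r (Rmin d1 d2) (Rmin d3 d4)).
  pose proof (Rmin_l d1 d2); pose proof (Rmin_r d1 d2).
  pose proof (Rmin_l d3 d4); pose proof (Rmin_r d3 d4); lra. }
specialize (H1 h ltac:(lra)); specialize (H2 h ltac:(lra)); specialize (H3 h ltac:(lra)).
specialize (H4 h ltac:(lra)); apply Rabs_le_between in H4.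
set (e := exp (c * h)) in *.
assert (He0 : 0 < e) by apply exp_pos.
replace (minus (minus (rscal e (f h)) x) (rscal h (plus y (rscal c x))))
  with (plus (rscal e (minus (minus (f h) x) (rscal h y)))
         (plus (rscal (e - 1 - c * h) x) (rscal (h * (e - 1)) y))) by vec.
assert (N1 : norm (rscal e (minus (minus (f h) x) (rscal h y))) <= 2 * (eps / q * h)).
{ eapply Rle_trans; [apply norm_rscal_nonneg; lra|].
  apply Rmult_le_compat; try lra; apply norm_nonneg. }
assert (N2 : norm (rscal (e - 1 - c * h) x) <= eps / q * h * norm x).
{ eapply Rle_trans; [apply norm_rscal_le|]; now apply Rmult_le_compat_r. }
assert (N3 : norm (rscal (h * (e - 1)) y) <= eps / q * h * norm y).
{ eapply Rle_trans; [apply norm_rscal_le|]; apply Rmult_le_compat_r; [exact Hy|].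
  rewrite Rabs_mult, Rabs_pos_eq, Rmult_comm by lra; apply Rmult_le_compat_r; lra. }
assert (Hq : eps * h = eps / q * h * q) by (field; unfold q; lra).
rewrite Hq; unfold q at 2.
eapply Rle_trans; [apply norm_plus_le|].
pose proof (norm_plus_le (rscal (e - 1 - c * h) x) (rscal (h * (e - 1)) y)); lra.
Qed.

Section Rescaled.
Context (T : C0_semigroup X) (c : R).
Let S (t : R) x := rscal (exp (c * t)) (T t x).

Lemma rescaled_linear t : 0 <= t -> is_linear (S t).
Proof.
intros Ht; unfold S; split.
- intros x y; change (rscal (exp (c * t)) (T t (plus x y)) =
    plus (rscal (exp (c * t)) (T t x)) (rscal (exp (c * t)) (T t y))).
  rewrite semigroup_add by exact Ht; vec.
- intros k x; change (rscal (exp (c * t)) (T t (scal (k : C_AbsRing) x)) =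
    scal (k : C_AbsRing) (rscal (exp (c * t)) (T t x))).
  rewrite semigroup_scal by exact Ht; vec.
- destruct (semigroup_bounded T t Ht) as (M & HM & H).
  pose proof (exp_pos (c * t)) as He.
  exists (exp (c * t) * M); split; [now apply Rmult_lt_0_compat|]; intros x.
  change (norm (rscal (exp (c * t)) (T t x)) <= exp (c * t) * M * norm x).
  eapply Rle_trans; [apply norm_rscal_nonneg; lra|].
  rewrite Rmult_assoc; apply Rmult_le_compat_l; [lra|apply H].
Qed.

Lemma rescaled_0 x : S 0 x = x.
Proof. unfold S; rewrite Rmult_0_r, exp_0, semigroup_0; vec. Qed.

Lemma rescaled_plus s t x : 0 <= s -> 0 <= t -> S (s + t) x = S s (S t x).
Proof.
intros Hs Ht; unfold S.
rewrite semigroup_plus, semigroup_rscal, Rmult_plus_distr_l, exp_plus by assumption; vec.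
Qed.

Lemma rescaled_continuous x : filterlim (fun t => S t x) (at_right 0) (locally x).
Proof.
apply filterlim_at_right_0_iff; intros eps Heps; pose proof (norm_nonneg x) as Hx.
set (e := eps / (3 + norm x)).
assert (He : 0 < e) by (apply Rdiv_lt_0_compat; lra).
assert (Hee : e * (3 + norm x) = eps) by (unfold e; field; lra).
destruct (semigroup_right_continuous T x e He) as (d1 & Hd1 & H1).
destruct (exp_linear_right_continuous c _ He) as (d2 & Hd2 & H2).
destruct (exp_linear_right_continuous c _ Rlt_0_1) as (d3 & Hd3 & H3).
exists (Rmin d1 (Rmin d2 d3)); split; [repeat apply Rmin_pos; assumption|]; intros h Hh.
pose proof (Rmin_l d1 (Rmin d2 d3)); pose proof (Rmin_r d1 (Rmin d2 d3)).
pose proof (Rmin_l d2 d3); pose proof (Rmin_r d2 d3).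
specialize (H1 h ltac:(lra)); specialize (H2 h ltac:(lra)); specialize (H3 h ltac:(lra)).
apply Rabs_le_between in H3; pose proof (exp_pos (c * h)); unfold S.
set (k := exp (c * h)) in *.
replace (minus (rscal k (T h x)) x)
  with (plus (rscal k (minus (T h x) x)) (rscal (k - 1) x)) by vec.
eapply Rle_lt_trans; [apply norm_plus_le|].
pose proof (norm_rscal_nonneg k (minus (T h x) x) ltac:(lra)) as N1.
assert (k * norm (minus (T h x) x) <= 2 * e).
{ apply Rmult_le_compat; try lra; apply norm_nonneg. }
pose proof (norm_rscal_le (k - 1) x) as N2.
apply (Rmult_le_compat_r (norm x)) in H2; [lra|exact Hx].
Qed.

Definition rescaled_semigroup : C0_semigroup X := {|
  semigroup := S;
  semigroup_linear := rescaled_linear;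
  semigroup_0 := rescaled_0;
  semigroup_plus := rescaled_plus;
  semigroup_continuous := rescaled_continuous |}.

(** Rescaling by [exp (c * t)] adds [c] to the generator, so [c = - l] turns [A] into [A - l]. One
    implication is the product rule, the other rescales back by [- c]. *)
Lemma generator_rescaled x y :
  graph (generator rescaled_semigroup) x (plus y (rscal c x)) <-> graph (generator T) x y.
Proof.
rewrite !generator_iff; split; intros H.
- apply (right_derivative_exp _ _ _ (- c)) in H; intros eps Heps.
  destruct (H eps Heps) as (d & Hd & Hh); exists d; split; [exact Hd|]; intros h Hh0.
  specialize (Hh h Hh0); simpl in Hh; unfold S in Hh.
  replace (plus (plus y (rscal c x)) (rscal (- c) x)) with y in Hh by vec.
  replace (rscal (exp (- c * h)) (rscal (exp (c * h)) (T h x)))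
    with (T h x) in Hh; [exact Hh|].
  transitivity (rscal (exp (- c * h) * exp (c * h)) (T h x)); [|vec].
  rewrite <- exp_plus; replace (- c * h + c * h) with 0 by ring; rewrite exp_0; vec.
- now apply right_derivative_exp.
Qed.

End Rescaled.

(** The operator norm is o(t^n), tested on vectors; [1 <= t0] keeps the powers of [t] positive. *)
Definition growth_little_o (n : nat) T : Prop :=
  forall eps, 0 < eps -> exists t0, 1 <= t0 /\ forall t, t0 <= t ->
    forall x, norm (T t x) <= eps * t ^ n * norm x.

Lemma rescaled_contractive n T l : growth_little_o n T -> 0 < l ->
  exists t, 0 < t /\ forall x, norm (rescaled_semigroup T (- l) t x) <= norm x / 2.
Proof.
intros HT Hl; destruct (HT 1 Rlt_0_1) as (t0 & Ht0 & H).
assert (Hn : 0 < INR (S n)) by (apply lt_0_INR; lia).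
set (b := (l / INR (S n)) ^ S n).
assert (Hb : 0 < b) by (now apply pow_lt, Rdiv_lt_0_compat).
assert (Hb' : 0 < / b) by now apply Rinv_0_lt_compat.
(* The term [2 / b] forces [b * t >= 2], hence [exp (l * t) >= b * t ^ S n >= 2 * t ^ n], which
   leaves the factor 1/2. *)
set (t := t0 + 2 / b).
assert (Ht : 0 < t) by (unfold t, Rdiv; lra).
exists t; split; [exact Ht|]; intros x.
change (norm (rscal (exp (- l * t)) (T t x)) <= norm x / 2).
pose proof (exp_pos (- l * t)) as He; pose proof (norm_nonneg x) as Hx.
pose proof (pow_lt t n Ht) as Htn.
eapply Rle_trans; [apply norm_rscal_nonneg; lra|].
specialize (H t ltac:(unfold t, Rdiv; lra) x).
assert (Hexp : 2 * t ^ n <= exp (l * t)).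
{ eapply Rle_trans; [|apply (exp_ge_pow n); apply Rmult_le_pos; lra].
  replace (l * t / INR (S n)) with (l / INR (S n) * t) by (field; lra).
  rewrite Rpow_mult_distr; fold b; cbn [pow].
  assert (2 <= b * t).
  { apply Rle_trans with (b * (2 / b)); [apply Req_le; field; lra|].
    apply Rmult_le_compat_l; unfold t; lra. }
  rewrite <- Rmult_assoc; apply Rmult_le_compat_r; lra. }
assert (Hinv : exp (- l * t) * exp (l * t) = 1).
{ rewrite <- exp_plus; replace (- l * t + l * t) with 0 by ring; apply exp_0. }
apply (Rmult_le_compat_l (exp (- l * t))) in Hexp; [|lra].
apply (Rmult_le_compat_l (exp (- l * t))) in H; [|lra].
apply (Rmult_le_compat_r (norm x)) in Hexp; [|exact Hx]; nra.
Qed.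

(** [J] is the bounded two-sided inverse of [l - A]: [resolvent_right] reads [A (J z) = l J z - z].
    Working with the graph records membership in the domain at the same time. *)
Record resolvent_at (A : linear_operator X) (l : R) (J : X -> X) (K : R) : Prop := {
  resolvent_bound : forall z, norm (J z) <= K * norm z;
  resolvent_right : forall z, graph A (J z) (minus (rscal l (J z)) z);
  resolvent_left : forall w v, graph A w v -> J (minus (rscal l w) v) = w
}.

Lemma generator_resolvent n T l : growth_little_o n T -> 0 < l ->
  exists J K, 0 <= K /\ resolvent_at (generator T) l J K.
Proof.
intros HT Hl; set (S := rescaled_semigroup T (- l)).
destruct (rescaled_contractive n T l HT Hl) as (t & Ht & Hhalf); fold S in Hhalf.
destruct (semigroup_locally_bounded S t) as (M & HM & HSM).
assert (HK : 0 <= t * M) by (apply Rmult_le_pos; lra).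
assert (Hsurj : forall z, exists w, graph (generator S) w z /\ norm w <= 2 * (t * M) * norm z).
{ intros z0; apply (successive_approximation _ (fun _ : X => True)); auto.
  { apply generator_closed. }
  intros z _; destruct (generator_orbit_average S t z M Ht) as (w & Hw & Hn); [auto|].
  (* [- w] solves for [z - S t z], and the remainder [S t z] has at most half the norm of [z]. *)
  exists (opp w), (minus z (S t z)); repeat split.
  - replace (opp w) with (rscal (-1) w) by vec.
    replace (minus z (S t z)) with (rscal (-1) (minus (S t z) z)) by vec.
    now apply rel_rscal; [apply generator_closed|].
  - now rewrite norm_opp_eq.
  - replace (minus z (minus z (S t z))) with (S t z) by vec; apply Hhalf. }
(* A vector in the kernel of [A - l] is fixed by [S t], which at least halves norms. *)
assert (Hinj : forall w, graph (generator T) w (rscal l w) -> w = zero).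
{ intros w Hw; apply (generator_rescaled T (- l)) in Hw; fold S in Hw.
  replace (plus (rscal l w) (rscal (- l) w)) with (zero : X) in Hw by vec.
  pose proof (generator_kernel_fixed S w t Hw ltac:(lra)) as Hfix.
  specialize (Hhalf w); rewrite Hfix in Hhalf.
  apply (norm_eq_zero (V := X)); pose proof (norm_nonneg w); apply Rle_antisym; lra. }
(* The sign turns the inverse of [A - l] into that of [l - A]. *)
set (J := fun z => opp (proj1_sig (constructive_indefinite_description _ (Hsurj z)))).
assert (HJ : forall z, graph (generator S) (opp (J z)) z /\ norm (J z) <= 2 * (t * M) * norm z).
{ intros z; unfold J.
  destruct (constructive_indefinite_description _ (Hsurj z)) as (w & Hw & Hn); simpl.
  rewrite norm_opp_eq; replace (opp (opp w)) with w by vec; auto. }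
assert (Hright : forall z, graph (generator T) (J z) (minus (rscal l (J z)) z)).
{ intros z; apply (generator_rescaled T (- l)); fold S.
  replace (plus (minus (rscal l (J z)) z) (rscal (- l) (J z))) with (rscal (-1) z) by vec.
  replace (J z) with (rscal (-1) (opp (J z))) by vec.
  apply rel_rscal; [apply generator_closed|apply HJ]. }
exists J, (2 * (t * M)); split; [lra|split].
- intros z; apply HJ.
- exact Hright.
- intros w v Hwv; apply minus_zero_eq, Hinj.
  set (z := minus (rscal l w) v).
  replace (rscal l (minus (J z) w)) with (minus (minus (rscal l (J z)) z) v)
    by (unfold z; vec).
  apply (rel_minus _ (generator_closed T)); auto.
Qed.

(** * Kernel vectors in the range of a power *)

Lemma power_graph_S_left (A : linear_operator X) k x y :
  power_graph A (S k) x y <-> exists z, graph A x z /\ power_graph A k z y.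
Proof.
revert y; induction k as [|k IH]; intros y.
- simpl; split.
  + intros (z & [Hx ->] & H); exists y; split; [exact H|].
    split; [apply (graph_carrier A H)|reflexivity].
  + intros (z & H & [Hz ->]); exists x; split; [|exact H].
    split; [apply (graph_carrier A H)|reflexivity].
- split.
  + intros (u & Hu & Hy); apply IH in Hu; destruct Hu as (z & Hz & Hzu).
    exists z; split; [exact Hz|exists u; auto].
  + intros (z & Hz & (u & Hu & Hy)); exists u; split; [|exact Hy].
    apply IH; exists z; auto.
Qed.

Fixpoint iterated_difference T (t : R) (k : nat) x : X :=
  match k with
  | O => x
  | S j => minus (T t (iterated_difference T t j x)) (iterated_difference T t j x)
  end.

Lemma iterated_difference_generator T t k x y : 0 <= t -> graph (generator T) x y ->
  graph (generator T) (iterated_difference T t k x) (iterated_difference T t k y).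
Proof.
intros Ht H; induction k as [|k IH]; [exact H|].
apply (rel_minus _ (generator_closed T)); [now apply generator_commute|exact IH].
Qed.

(** Iterated differences commute with the generator, so by induction the k-th difference of [x] is a
    vector that the generator sends to [t ^ k y]. The latter is fixed by the semigroup; the orbit is
    therefore affine, and one more difference contributes a factor [t]. *)
Lemma iterated_difference_pow T t k x y : 0 <= t ->
  power_graph (generator T) k x y -> graph (generator T) y zero ->
  iterated_difference T t k x = rscal (t ^ k) y.
Proof.
intros Ht; revert x; induction k as [|k IH]; intros x Hxy Hy.
- destruct Hxy as [_ ->]; simpl; vec.
- apply power_graph_S_left in Hxy; destruct Hxy as (z & Hz & Hzy).
  specialize (IH z Hzy Hy).
  apply (iterated_difference_generator T t k) in Hz; [|exact Ht]; rewrite IH in Hz.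
  simpl; rewrite (generator_orbit_affine T _ _ t Hz); [vec| |exact Ht].
  intros s Hs; rewrite semigroup_rscal, (generator_kernel_fixed T y s Hy Hs) by exact Hs.
  reflexivity.
Qed.

(* Evaluating at [(m + 1) t] rather than at [m t] keeps the case [n = 0], where
   [x] itself is not o(1). *)
Lemma iterated_difference_growth n T k x : growth_little_o n T ->
  forall m eps, 0 < eps -> exists t0, 1 <= t0 /\ forall t, t0 <= t ->
    norm (T (INR (S m) * t) (iterated_difference T t k x)) <= eps * t ^ n.
Proof.
intros HT; induction k as [|k IH]; intros m eps Heps.
- assert (Hm : 1 <= INR (S m)) by (apply (le_INR 1); lia).
  assert (Hp : 0 < INR (S m) ^ n) by (apply pow_lt; lra).
  pose proof (norm_nonneg x) as Hx.
  destruct (HT (eps / (INR (S m) ^ n * (norm x + 1)))) as (t0 & Ht0 & H).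
  { apply Rdiv_lt_0_compat; [exact Heps|apply Rmult_lt_0_compat; lra]. }
  exists t0; split; [exact Ht0|]; intros t Ht.
  cbn [iterated_difference]; eapply Rle_trans; [apply H; nra|].
  rewrite Rpow_mult_distr.
  assert (Htn : 0 < t ^ n) by (apply pow_lt; lra).
  set (p := INR (S m) ^ n) in *; set (q := t ^ n) in *; clearbody p q.
  apply Rle_trans with (eps * q * (norm x / (norm x + 1))); [apply Req_le; field; lra|].
  apply Rle_trans with (eps * q * 1); [|lra].
  apply Rmult_le_compat_l; [nra|].
  apply (Rmult_le_reg_r (norm x + 1)); [lra|].
  replace (norm x / (norm x + 1) * (norm x + 1)) with (norm x) by (field; lra); lra.
- destruct (IH (S m) (eps / 2) ltac:(lra)) as (t1 & Ht1 & H1).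
  destruct (IH m (eps / 2) ltac:(lra)) as (t2 & Ht2 & H2).
  exists (Rmax t1 t2); pose proof (Rmax_l t1 t2); pose proof (Rmax_r t1 t2).
  split; [lra|]; intros t Ht; specialize (H1 t ltac:(lra)); specialize (H2 t ltac:(lra)).
  assert (Hmt : 0 <= INR (S m) * t) by (apply INR_mult_nonneg; lra).
  cbn [iterated_difference]; rewrite semigroup_minus, <- semigroup_plus by lra.
  rewrite (S_INR (S m)), Rmult_plus_distr_r, Rmult_1_l in H1.
  eapply Rle_trans; [apply norm_minus_le|]; lra.
Qed.

Lemma kernel_range_disjoint n T x y : growth_little_o n T ->
  power_graph (generator T) n x y -> graph (generator T) y zero -> y = zero.
Proof.
intros HT Hxy Hy; apply (norm_small_zero 1); [lra|]; intros eps Heps.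
destruct (iterated_difference_growth n T n x HT O eps Heps) as (t & Ht & H).
specialize (H t (Rle_refl t)).
rewrite (iterated_difference_pow T t n x y) in H by (auto; lra).
replace (INR 1 * t) with t in H by (simpl; ring).
rewrite semigroup_rscal, (generator_kernel_fixed T y t Hy) in H by lra.
pose proof (pow_lt t n ltac:(lra)) as Hp.
assert (Hy' : norm y <= / t ^ n * norm (rscal (t ^ n) y)).
{ replace y with (rscal (/ t ^ n) (rscal (t ^ n) y)) at 1 by (vec_field; lra).
  apply norm_rscal_nonneg, Rlt_le, Rinv_0_lt_compat, Hp. }
apply (Rmult_le_compat_l (/ t ^ n)) in H; [|apply Rlt_le, Rinv_0_lt_compat, Hp].
replace (/ t ^ n * (eps * t ^ n)) with eps in H by (field; lra); lra.
Qed.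

End Growth.

(** * Closedness of ranges of finite codimension *)

Section ClosedRange.
Context {X : CompleteNormedModule C_AbsRing}.
Implicit Types (x y z : X).

Definition relation_range (G : X -> X -> Prop) z : Prop := exists y, G y z.

Lemma span_0 (e : nat -> X) x : span 0 e x <-> x = zero.
Proof.
unfold span; split; [intros [c ->]|intros ->; exists (fun _ => RtoC 0)].
- apply sum_n_m_zero; lia.
- symmetry; apply sum_n_m_zero; lia.
Qed.

Lemma span_S q (e : nat -> X) x :
  span (S q) e x -> exists y (k : C), span q e y /\
    x = plus y (scal (k : C_AbsRing) (e (S q))).
Proof.
intros [c ->].
exists (sum_n_m (fun i => scal (c i : C_AbsRing) (e i)) 1 q), (c (S q)).
split; [now exists c|apply sum_n_Sm; lia].
Qed.

Lemma sequential_choice (P : R -> X -> X -> C -> Prop) :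
  (forall eps, 0 < eps -> exists x y c, P eps x y c) ->
  exists (u v : nat -> X) (c : nat -> C), forall n, P ((1 / 2) ^ n) (u n) (v n) (c n).
Proof.
intros H.
assert (Hn : forall n : nat, exists p : X * X * C,
   P ((1 / 2) ^ n) (fst (fst p)) (snd (fst p)) (snd p)).
{ intros n; destruct (H ((1 / 2) ^ n)) as (x & y & c & Hp); [apply pow_lt; lra|].
  now exists (x, y, c). }
set (p := fun n => proj1_sig (constructive_indefinite_description _ (Hn n))).
exists (fun n => fst (fst (p n))), (fun n => snd (fst (p n))), (fun n => snd (p n)).
intros n; exact (proj2_sig (constructive_indefinite_description _ (Hn n))).
Qed.

Lemma scal_cancel (k : C) x : k <> RtoC 0 ->
  scal (Cinv k : C_AbsRing) (scal (k : C_AbsRing) x) = x.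
Proof.
intros Hk.
transitivity (scal (Cmult (Cinv k) k : C_AbsRing) x).
- exact (scal_assoc (V := X) (Cinv k : C_AbsRing) k x).
- rewrite Cinv_l by exact Hk; apply scal_C1.
Qed.

Section OneVector.
Context (G : X -> X -> Prop) (HG : closed_relation G) (e : X).
Context (He : ~ relation_range G e).

(** Its range is R(G) plus the line through [e], a direct sum because [e] is outside R(G). The
    scalar is not recorded in the pair, so closedness depends on bounding it. *)
Definition relation_add_line y z : Prop :=
  exists c : C, G y (minus z (scal (c : C_AbsRing) e)).

Lemma line_coefficient_zero y (c : C) : G y (scal (c : C_AbsRing) e) -> c = RtoC 0.
Proof.
intros H; apply NNPP; intros Hc; apply He.
exists (scal (Cinv c : C_AbsRing) y).
rewrite <- (scal_cancel c e Hc); now apply (rel_scal G HG).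
Qed.

(** If no bound held, dividing by the coefficients would give pairs of [G] converging to [(0, - e)],
    and closedness would put [e] in the range. *)
Lemma line_coefficient_bound : exists K, 0 <= K /\ forall y z (c : C),
  G y (minus z (scal (c : C_AbsRing) e)) -> Cmod c <= K * (norm y + norm z).
Proof.
apply NNPP; intros Hno; apply He.
assert (H0 : G zero (scal (RtoC (-1) : C_AbsRing) e)).
{ apply (rel_closed G HG); intros eps Heps; apply NNPP; intros Hn; apply Hno.
  assert (Hi : 0 < / eps) by now apply Rinv_0_lt_compat.
  exists (/ eps); split; [lra|]; intros y z c H.
  apply Rnot_lt_le; intros Hlt; apply Hn.
  pose proof (norm_nonneg y) as Hy; pose proof (norm_nonneg z) as Hz.
  assert (Hc : 0 < Cmod c).
  { eapply Rle_lt_trans; [|exact Hlt]; apply Rmult_le_pos; lra. }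
  assert (Hc0 : c <> RtoC 0) by (intros ->; rewrite Cmod_0 in Hc; lra).
  apply (Rmult_lt_compat_l (eps / Cmod c)) in Hlt; [|now apply Rdiv_lt_0_compat].
  replace (eps / Cmod c * (/ eps * (norm y + norm z)))
    with (/ Cmod c * norm y + / Cmod c * norm z) in Hlt by (field; lra).
  replace (eps / Cmod c * Cmod c) with eps in Hlt by (field; lra).
  assert (Hic : 0 < / Cmod c) by now apply Rinv_0_lt_compat.
  assert (0 <= / Cmod c * norm y) by (apply Rmult_le_pos; lra).
  assert (0 <= / Cmod c * norm z) by (apply Rmult_le_pos; lra).
  pose proof (norm_scal_le (Cinv c) y) as Ny; pose proof (norm_scal_le (Cinv c) z) as Nz.
  rewrite Cmod_inv in Ny, Nz by exact Hc0.
  exists (scal (Cinv c : C_AbsRing) y), (minus (scal (Cinv c : C_AbsRing) z) e).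
  split; [|split].
  - rewrite <- (scal_cancel c e Hc0).
    replace (minus (scal (Cinv c : C_AbsRing) z)
        (scal (Cinv c : C_AbsRing) (scal (c : C_AbsRing) e)))
      with (scal (Cinv c : C_AbsRing) (minus z (scal (c : C_AbsRing) e))) by vec.
    now apply (rel_scal G HG).
  - replace (minus (scal (Cinv c : C_AbsRing) y) zero)
      with (scal (Cinv c : C_AbsRing) y) by vec; lra.
  - replace (minus (minus (scal (Cinv c : C_AbsRing) z) e) (scal (RtoC (-1) : C_AbsRing) e))
      with (scal (Cinv c : C_AbsRing) z) by vec; lra. }
exists zero; apply (rel_scal G HG (RtoC (-1))) in H0.
replace (scal (RtoC (-1) : C_AbsRing) (zero : X)) with (zero : X) in H0 by vec.
replace (scal (RtoC (-1) : C_AbsRing) (scal (RtoC (-1) : C_AbsRing) e)) with e in H0 by vec.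
exact H0.
Qed.

(** Along a convergent sequence of pairs the coefficients are Cauchy by [line_coefficient_bound],
    and their limit serves the limit pair. *)
Lemma relation_add_line_closed : closed_relation relation_add_line.
Proof.
destruct line_coefficient_bound as (K & HK & Hbound).
split.
- exists (RtoC 0); replace (minus zero (scal (RtoC 0 : C_AbsRing) e)) with (zero : X) by vec.
  apply (rel_zero G HG).
- intros x y x' y' [c Hc] [c' Hc']; exists (Cplus c c').
  replace (minus (plus y y') (scal (Cplus c c' : C_AbsRing) e))
    with (plus (minus y (scal (c : C_AbsRing) e)) (minus y' (scal (c' : C_AbsRing) e))) by vec.
  now apply (rel_plus G HG).
- intros k x y [c Hc]; exists (Cmult k c).
  replace (minus (scal (k : C_AbsRing) y) (scal (Cmult k c : C_AbsRing) e))
    with (scal (k : C_AbsRing) (minus y (scal (c : C_AbsRing) e))) by vec.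
  now apply (rel_scal G HG).
- intros x y Hxy.
  destruct (sequential_choice (fun eps x' y' c =>
     G x' (minus y' (scal (c : C_AbsRing) e)) /\ norm (minus x' x) < eps /\
     norm (minus y' y) < eps)) as (u & v & c & H).
  { intros eps Heps; destruct (Hxy eps Heps) as (x' & y' & [c Hc] & Hx & Hy).
    exists x', y', c; auto. }
  destruct (cauchy_tends_to (X := C_CompleteNormedModule) c) as [c0 Hc0].
  { intros eps Heps.
    destruct (pow_half_small (4 * K) eps Heps) as [N HN]; exists N; intros n m Hn Hm.
    destruct (H n) as (Gn & Hxn & Hyn); destruct (H m) as (Gm & Hxm & Hym).
    pose proof (rel_minus G HG _ _ _ _ Gn Gm) as Gnm.
    replace (minus (minus (v n) (scal (c n : C_AbsRing) e))
         (minus (v m) (scal (c m : C_AbsRing) e)))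
      with (minus (minus (v n) (v m)) (scal (Cminus (c n) (c m) : C_AbsRing) e)) in Gnm by vec.
    apply Hbound in Gnm.
    change (Cmod (Cminus (c n) (c m)) < eps).
    assert (Hpow : forall k, (N <= k)%nat -> (1 / 2) ^ k <= (1 / 2) ^ N).
    { intros k Hk; replace k with (N + (k - N))%nat by lia; rewrite pow_add.
      pose proof (pow_lt (1 / 2) N ltac:(lra)).
      pose proof (pow_incr (1 / 2) 1 (k - N) ltac:(lra)) as Hk1; rewrite pow1 in Hk1; nra. }
    pose proof (Hpow n Hn); pose proof (Hpow m Hm).
    pose proof (norm_minus_trans (u n) x (u m)) as Nu.
    pose proof (norm_minus_trans (v n) y (v m)) as Nv.
    rewrite (norm_minus_sym x (u m)) in Nu; rewrite (norm_minus_sym y (v m)) in Nv.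
    specialize (HN N (le_n N)).
    assert (K * (norm (minus (u n) (u m)) + norm (minus (v n) (v m)))
       <= K * (4 * (1 / 2) ^ N)) by (apply Rmult_le_compat_l; lra).
    lra. }
  exists c0; apply (rel_closed G HG); intros eps Heps.
  pose proof (norm_nonneg e) as Hne.
  assert (He2 : 0 < eps / (2 * (norm e + 1))) by (apply Rdiv_lt_0_compat; lra).
  destruct (Hc0 _ He2) as [N1 HN1].
  destruct (pow_half_small 1 (eps / 2) ltac:(lra)) as [N2 HN2].
  set (n := (N1 + N2)%nat).
  specialize (HN1 n ltac:(lia)); specialize (HN2 n ltac:(lia)); rewrite Rmult_1_l in HN2.
  change (Cmod (Cminus (c n) c0) < eps / (2 * (norm e + 1))) in HN1.
  destruct (H n) as (Gn & Hxn & Hyn).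
  exists (u n), (minus (v n) (scal (c n : C_AbsRing) e)); split; [exact Gn|split; [lra|]].
  replace (minus (minus (v n) (scal (c n : C_AbsRing) e)) (minus y (scal (c0 : C_AbsRing) e)))
    with (minus (minus (v n) y) (scal (Cminus (c n) c0 : C_AbsRing) e)) by vec.
  eapply Rle_lt_trans; [apply norm_minus_le|].
  pose proof (norm_scal_le (Cminus (c n) c0) e).
  assert (Cmod (Cminus (c n) c0) * norm e <= eps / (2 * (norm e + 1)) * (norm e + 1)).
  { apply Rmult_le_compat; try lra; apply Cmod_ge_0. }
  replace (eps / (2 * (norm e + 1)) * (norm e + 1)) with (eps / 2) in * by (field; lra); lra.
Qed.

(** A limit [z] of points [v] of R(G) lies in the enlarged range, with some coefficient [c]. The
    open mapping theorem solves for [z - v] with a small preimage, hence a small coefficient; as [e]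
    is outside R(G) that coefficient equals [c], so [c = 0]. *)
Lemma relation_range_closed_of_add_line :
  norm_closed (relation_range relation_add_line) ->
  norm_closed (relation_range G).
Proof.
intros HZ z Hz.
destruct line_coefficient_bound as (K & HK & Hbound).
destruct (open_mapping relation_add_line _ relation_add_line_closed HZ) as (K' & HK' & Hopen).
{ intros y v H; now exists y. }
{ auto. }
assert (Hincl : forall v, relation_range G v -> relation_range relation_add_line v).
{ intros v [y Hy]; exists y, (RtoC 0).
  now replace (minus v (scal (RtoC 0 : C_AbsRing) e)) with v by vec. }
assert (HzZ : relation_range relation_add_line z).
{ apply HZ; intros eps Heps; destruct (Hz eps Heps) as (v & Hv & Hvz); eauto. }
destruct HzZ as (y & c & Hy).
assert (Hc : c = RtoC 0).
{ apply Cmod_eq_0, Rle_antisym; [|apply Cmod_ge_0].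
  apply (le_epsilon_scaled _ _ (K * (K' + 1))); [apply Rmult_le_pos; lra|].
  intros eps Heps; rewrite Rplus_0_l.
  destruct (Hz eps Heps) as (v & [w Hw] & Hvz).
  destruct (Hopen (minus z v)) as (y' & [c' Hc'] & Hy').
  { exists (minus y w), c.
    replace (minus (minus z v) (scal (c : C_AbsRing) e))
      with (minus (minus z (scal (c : C_AbsRing) e)) v) by vec.
    now apply rel_minus. }
  assert (Hcc : Cminus c' c = RtoC 0).
  { apply (line_coefficient_zero (minus (minus y y') w)).
    replace (scal (Cminus c' c : C_AbsRing) e)
      with (minus (minus (minus z (scal (c : C_AbsRing) e))
         (minus (minus z v) (scal (c' : C_AbsRing) e))) v) by vec.
    now repeat apply rel_minus. }
  replace c with c'.
  2:{ replace c' with (Cplus (Cminus c' c) c) by ring; rewrite Hcc; ring. }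
  apply Hbound in Hc'; rewrite (norm_minus_sym z v) in *.
  eapply Rle_trans; [exact Hc'|]; rewrite Rmult_assoc; apply Rmult_le_compat_l; [exact HK|].
  assert (K' * norm (minus v z) <= K' * eps) by (apply Rmult_le_compat_l; lra); lra. }
exists y; subst c.
now replace (minus z (scal (RtoC 0 : C_AbsRing) e)) with z in Hy by vec.
Qed.

End OneVector.

(* Kato's theorem; the induction adjoins to the relation one vector of a
   complement of the range at a time. *)
Lemma finite_codimension_closed (Y : X -> Prop) q : norm_closed Y ->
  forall (G : X -> X -> Prop) (e : nat -> X), closed_relation G ->
  (forall z, relation_range G z -> Y z) ->
  (forall z, Y z -> exists v, relation_range G v /\ span q e (minus z v)) ->
  (forall i, (1 <= i <= q)%nat -> Y (e i)) ->
  (forall x y, Y x -> Y y -> Y (plus x y)) ->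
  (forall (k : C) x, Y x -> Y (scal (k : C_AbsRing) x)) ->
  norm_closed (relation_range G).
Proof.
intros HY; induction q as [|q IH]; intros G e HG HGY Hspan HeY Hplus Hscal.
- intros z Hz.
  assert (HYz : Y z).
  { apply HY; intros eps Heps; destruct (Hz eps Heps) as (v & Hv & Hvz); eauto. }
  destruct (Hspan z HYz) as (v & Hv & H0); apply span_0, minus_zero_eq in H0; now subst.
(* A last vector already in the range is absorbed into [v]; otherwise it is adjoined to the
   relation. Either way [q] vectors remain. *)
- destruct (classic (relation_range G (e (S q)))) as [He|He].
  + apply (IH G e); auto; [|intros i Hi; apply HeY; lia].
    intros z Hz; destruct (Hspan z Hz) as (v & [w Hw] & Hs).
    apply span_S in Hs; destruct Hs as (y & k & Hy & Hk); destruct He as [w' Hw'].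
    exists (plus v (scal (k : C_AbsRing) (e (S q)))); split.
    * exists (plus w (scal (k : C_AbsRing) w')).
      apply (rel_plus G HG); [exact Hw|now apply (rel_scal G HG)].
    * replace (minus z (plus v (scal (k : C_AbsRing) (e (S q)))))
        with (minus (minus z v) (scal (k : C_AbsRing) (e (S q)))) by vec.
      rewrite Hk.
      now replace (minus (plus y (scal (k : C_AbsRing) (e (S q))))
        (scal (k : C_AbsRing) (e (S q)))) with y by vec.
  + apply (relation_range_closed_of_add_line G HG (e (S q)) He).
    apply (IH _ e); auto.
    * now apply relation_add_line_closed.
    * intros z (y & c & Hc).
      replace z with (plus (minus z (scal (c : C_AbsRing) (e (S q))))
          (scal (c : C_AbsRing) (e (S q)))) by vec.
      apply Hplus; [apply HGY; now exists y|apply Hscal, HeY; lia].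
    * intros z Hz; destruct (Hspan z Hz) as (v & [w Hw] & Hs).
      apply span_S in Hs; destruct Hs as (y & k & Hy & Hk).
      exists (plus v (scal (k : C_AbsRing) (e (S q)))); split.
      -- exists w, k.
         now replace (minus (plus v (scal (k : C_AbsRing) (e (S q))))
           (scal (k : C_AbsRing) (e (S q)))) with v by vec.
      -- replace (minus z (plus v (scal (k : C_AbsRing) (e (S q)))))
           with (minus (minus z v) (scal (k : C_AbsRing) (e (S q)))) by vec.
         rewrite Hk.
         now replace (minus (plus y (scal (k : C_AbsRing) (e (S q))))
           (scal (k : C_AbsRing) (e (S q)))) with y by vec.
    * intros i Hi; apply HeY; lia.
Qed.

(** * Bounded operators and direct sums *)

Record bounded_linear (D : X -> X) : Prop := {
  bounded_linear_plus : forall x y, D (plus x y) = plus (D x) (D y);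
  bounded_linear_scal : forall (k : C) x,
    D (scal (k : C_AbsRing) x) = scal (k : C_AbsRing) (D x);
  bounded_linear_norm : exists B, 0 <= B /\ forall x, norm (D x) <= B * norm x
}.

Lemma bounded_linear_minus D (HD : bounded_linear D) x y :
  D (minus x y) = minus (D x) (D y).
Proof.
replace (minus x y) with (plus x (scal (RtoC (-1) : C_AbsRing) y)) by vec.
rewrite (bounded_linear_plus D HD), (bounded_linear_scal D HD); vec.
Qed.

Lemma bounded_linear_zero D (HD : bounded_linear D) : D zero = zero.
Proof.
replace (zero : X) with (minus zero zero : X) at 1 by vec.
rewrite (bounded_linear_minus D HD); vec.
Qed.

Lemma bounded_linear_comp D E :
  bounded_linear D -> bounded_linear E -> bounded_linear (fun x => D (E x)).
Proof.
intros HD HE; split.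
- intros x y; now rewrite (bounded_linear_plus E HE), (bounded_linear_plus D HD).
- intros k x; now rewrite (bounded_linear_scal E HE), (bounded_linear_scal D HD).
- destruct (bounded_linear_norm D HD) as (B & HB & HDB).
  destruct (bounded_linear_norm E HE) as (B' & HB' & HEB).
  exists (B * B'); split; [now apply Rmult_le_pos|]; intros x.
  eapply Rle_trans; [apply HDB|]; rewrite Rmult_assoc; now apply Rmult_le_compat_l.
Qed.

Lemma bounded_linear_iter D k : bounded_linear D -> bounded_linear (Nat.iter k D).
Proof.
intros HD; induction k as [|k IH]; [|exact (bounded_linear_comp _ _ HD IH)].
split; [reflexivity|reflexivity|]; exists 1; split; [lra|]; intros x; simpl; lra.
Qed.

(** With [E] the identity this is the graph of [D] restricted to [Y]; with the square of [D] against
    [D] it expresses the equation [D (D u) = D x]. *)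
Lemma closed_relation_equalizer (Y : X -> Prop) D E : bounded_linear D -> bounded_linear E ->
  is_subspace Y -> norm_closed Y -> closed_relation (fun x y => Y x /\ D x = E y).
Proof.
intros HD HE (Y0 & Yplus & Yscal) HY; split.
- now rewrite !bounded_linear_zero.
- intros x y x' y' [Hx H] [Hx' H']; split; [now apply Yplus|].
  now rewrite (bounded_linear_plus D HD), (bounded_linear_plus E HE), H, H'.
- intros k x y [Hx H]; split; [now apply Yscal|].
  now rewrite (bounded_linear_scal D HD), (bounded_linear_scal E HE), H.
- intros x y H; split.
  + apply HY; intros eps Heps; destruct (H eps Heps) as (x' & y' & [Hx' _] & Hx & _).
    now exists x'.
  + destruct (bounded_linear_norm D HD) as (B & HB & HDB).
    destruct (bounded_linear_norm E HE) as (B' & HB' & HEB).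
    apply (norm_small_eq (B + B')); [lra|]; intros eps Heps.
    destruct (H eps Heps) as (x' & y' & [_ Heq] & Hx & Hy).
    replace (minus (D x) (E y)) with (minus (E (minus y' y)) (D (minus x' x)))
      by (rewrite !bounded_linear_minus by assumption; rewrite Heq; vec).
    eapply Rle_trans; [apply norm_minus_le|].
    specialize (HDB (minus x' x)); specialize (HEB (minus y' y)).
    apply Rlt_le, (Rmult_le_compat_l B) in Hx; [|exact HB].
    apply Rlt_le, (Rmult_le_compat_l B') in Hy; [|exact HB']; lra.
Qed.

Lemma norm_closed_true : norm_closed (fun _ : X => True).
Proof. intros x _; exact I. Qed.

(* If X is the direct sum of N(D) and R(D), the component of [x] in N(D) is
   bounded by the open mapping theorem applied to the relation D^2 u = D x. *)
Lemma closed_range_direct_sum D : bounded_linear D ->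
  (forall x, exists u, D (D u) = D x) -> (forall x, D (D x) = zero -> D x = zero) ->
  norm_closed (fun y => exists x, y = D x).
Proof.
intros HD Hsum Hdirect y Hy.
destruct (open_mapping (fun u x => True /\ D (D u) = D x) (fun _ => True))
  as (K & HK & Hopen).
{ apply closed_relation_equalizer; auto using bounded_linear_comp, full_subspace,
    norm_closed_true. }
{ apply norm_closed_true. }
{ auto. }
{ intros x _; destruct (Hsum x) as [u Hu]; now exists u. }
destruct (bounded_linear_norm D HD) as (B & HB & HDB).
(* [D u] and [y] have the same image under [D]; it remains to see that they coincide. *)
destruct (Hsum y) as [u Hu]; exists u.
apply (norm_small_eq (1 + B * K));
  [assert (0 <= B * K) by (now apply Rmult_le_pos); lra|].
intros eps Heps; destruct (Hy eps Heps) as (v & [x ->] & Hv).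
rewrite norm_minus_sym in Hv.
destruct (Hopen (minus y (D x)) I) as (u' & [_ Hu'] & Hn).
(* The square of [D] kills [u - u' - x], hence so does [D]; thus [y - D u] is [(y - D x) - D u'],
   and both terms are small. *)
assert (H0 : D (minus (minus u u') x) = zero).
{ apply Hdirect; rewrite !(bounded_linear_minus D HD), Hu, Hu', (bounded_linear_minus D HD).
  vec. }
rewrite !(bounded_linear_minus D HD) in H0.
replace (minus y (D u)) with
  (minus (minus y (D x)) (plus (D u') (minus (minus (D u) (D u')) (D x)))) by vec.
rewrite H0; replace (plus (D u') zero) with (D u') by vec.
eapply Rle_trans; [apply norm_minus_le|].
specialize (HDB u'); apply (Rmult_le_compat_l B) in Hn; [|exact HB].
assert (B * (K * norm (minus y (D x))) <= B * (K * eps)).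
{ apply Rmult_le_compat_l; [exact HB|]; apply Rmult_le_compat_l; lra. }
lra.
Qed.

End ClosedRange.

(** * Ranges of powers and the bounded operator A (l - A)^-1 *)

Section GeneratorTheory.
Context {X : CompleteNormedModule C_AbsRing}.
Implicit Types (x y z : X).

Section PowerRanges.
Context (A : linear_operator X).

Local Notation rng k := (range (power A k)).

Lemma range_power_rscal k r x : rng k x -> rng k (rscal r x).
Proof. intros H; now apply (range_power_subspace A k). Qed.

Lemma range_power_minus k x y : rng k x -> rng k y -> rng k (minus x y).
Proof.
intros Hx Hy; replace (minus x y) with (plus x (rscal (-1) y)) by vec.
apply (range_power_subspace A k); [exact Hx|now apply range_power_rscal].
Qed.

Lemma range_power_S k y : rng (S k) y <-> exists x, rng k x /\ graph A x y.
Proof.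
split.
- intros (u & x & Hux & Hxy); exists x; split; [now exists u|exact Hxy].
- intros (x & [u Hux] & Hxy); exists u; exists x; auto.
Qed.

Lemma range_power_decr k y : rng (S k) y -> rng k y.
Proof.
intros H; apply range_power_S in H; destruct H as (x & Hx & Hxy).
exact (proj2 (restr_graph_carrier A k x y (conj Hx Hxy))).
Qed.

Lemma range_power_add_decr k j y : rng (k + j) y -> rng k y.
Proof.
induction j as [|j IH]; [now rewrite Nat.add_0_r|].
rewrite Nat.add_succ_r; intros H; now apply IH, range_power_decr.
Qed.

Lemma range_power_stable d : (forall y, rng d y -> rng (S d) y) ->
  forall j y, rng d y -> rng (d + j) y.
Proof.
intros Hd; induction j as [|j IH]; intros y Hy; [now rewrite Nat.add_0_r|].
rewrite Nat.add_succ_r; apply range_power_S.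
apply Hd, range_power_S in Hy; destruct Hy as (x & Hx & Hxy); exists x; auto.
Qed.

End PowerRanges.

Section BoundedModel.
Context (A : linear_operator X) (l : R) (J : X -> X) (K : R).
Context (Hfull : forall x, carrier A x) (HA : closed_relation (graph A)).
Context (Hl : 0 < l) (HK : 0 <= K) (HJ : resolvent_at A l J K).

Local Notation rng k := (range (power A k)).

Lemma resolvent_plus x y : J (plus x y) = plus (J x) (J y).
Proof.
rewrite <- (resolvent_left A l J K HJ (plus (J x) (J y))
  (plus (minus (rscal l (J x)) x) (minus (rscal l (J y)) y))).
- f_equal; vec.
- apply (rel_plus _ HA); apply HJ.
Qed.

Lemma resolvent_scal (k : C) x :
  J (scal (k : C_AbsRing) x) = scal (k : C_AbsRing) (J x).
Proof.
rewrite <- (resolvent_left A l J K HJ (scal (k : C_AbsRing) (J x))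
  (scal (k : C_AbsRing) (minus (rscal l (J x)) x))).
- f_equal; vec.
- apply (rel_scal _ HA); apply HJ.
Qed.

Lemma resolvent_linear : bounded_linear J.
Proof.
split; [apply resolvent_plus|apply resolvent_scal|].
exists K; split; [exact HK|apply HJ].
Qed.

(* This is A (l - A)^-1. *)
Definition bounded_model x : X := minus (rscal l (J x)) x.

Lemma bounded_model_linear : bounded_linear bounded_model.
Proof.
unfold bounded_model; split.
- intros x y; rewrite resolvent_plus; vec.
- intros k x; rewrite resolvent_scal; vec.
- exists (l * K + 1); split; [assert (0 <= l * K) by (apply Rmult_le_pos; lra); lra|].
  intros x; eapply Rle_trans; [apply norm_minus_le|].
  pose proof (norm_rscal_nonneg l (J x) ltac:(lra)) as H.
  pose proof (resolvent_bound A l J K HJ x) as H1.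
  apply (Rmult_le_compat_l l) in H1; lra.
Qed.

(** Since [J (l x - y) = x], linearity gives [J y = l J x - x], which is [A (J x)]. *)
Lemma resolvent_generator_graph x y : graph A x y -> graph A (J x) (J y).
Proof.
intros H; pose proof (resolvent_left A l J K HJ x y H) as Hx.
replace (J y) with (minus (rscal l (J x)) x); [apply HJ|].
rewrite <- Hx at 2; rewrite (bounded_linear_minus J resolvent_linear).
unfold rscal at 2; rewrite resolvent_scal; vec.
Qed.

Lemma resolvent_range_power k y : rng k y -> rng k (J y).
Proof.
intros [x Hx]; exists (J x); revert y Hx; simpl; induction k as [|k IH]; intros y.
- intros [_ ->]; split; [apply Hfull|reflexivity].
- intros (z & Hxz & Hzy); exists (J z); split; [now apply IH|].
  now apply resolvent_generator_graph.
Qed.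

(** If [y = A z] with [z] in R(A^k), then [l z - y] lies in R(A^k) and is mapped to [y]; conversely
    [bounded_model v = A (J v)], and [J] preserves R(A^k). *)
Lemma bounded_model_range_power k y :
  rng k y <-> exists x, y = Nat.iter k bounded_model x.
Proof.
revert y; induction k as [|k IH]; intros y.
- split; [intros [x [_ ->]]; now exists x|intros [x ->]].
  exists x; split; [apply Hfull|reflexivity].
- rewrite range_power_S; split.
  + intros (z & Hz & Hzy).
    assert (Hb : rng k (minus (rscal l z) y)).
    { apply range_power_minus; [now apply range_power_rscal|].
      apply range_power_decr, range_power_S; now exists z. }
    apply IH in Hb; destruct Hb as [x Hx]; exists x; simpl; rewrite <- Hx.
    unfold bounded_model; rewrite (resolvent_left A l J K HJ z y Hzy); vec.
  + intros [x ->]; exists (J (Nat.iter k bounded_model x)); split; [|apply HJ].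
    apply resolvent_range_power, IH; now exists x.
Qed.

Lemma bounded_model_kernel x : bounded_model x = zero -> graph A x zero.
Proof.
intros H; pose proof (resolvent_right A l J K HJ x) as Hx; fold (bounded_model x) in Hx.
rewrite H in Hx; apply minus_zero_eq in H; apply (rel_rscal _ HA l) in Hx.
rewrite H in Hx; now replace (rscal l (zero : X)) with (zero : X) in Hx by vec.
Qed.

Lemma bounded_model_iter_injective p :
  (forall x, rng p x -> graph A x zero -> x = zero) ->
  forall k x, rng p x -> Nat.iter k bounded_model x = zero -> x = zero.
Proof.
intros Hinj; induction k as [|k IH]; intros x Hx H0; [exact H0|].
rewrite Nat.iter_succ_r in H0.
assert (HCx : rng p (bounded_model x)).
{ apply range_power_minus; [|exact Hx]; now apply range_power_rscal, resolvent_range_power. }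
apply Hinj; [exact Hx|]; apply bounded_model_kernel; now apply IH.
Qed.

(** For [D] the p-th power of [bounded_model], stability gives R(D^2) = R(D) and injectivity makes
    N(D) meet R(D) only in 0; so X is the direct sum of N(D) and R(D). *)
Lemma range_power_closed_of_stable p :
  (forall x, rng p x -> graph A x zero -> x = zero) ->
  (forall y, rng p y -> rng (S p) y) -> norm_closed (rng p).
Proof.
intros Hinj Hstab; set (D := Nat.iter p bounded_model).
assert (HD : bounded_linear D) by apply bounded_linear_iter, bounded_model_linear.
assert (Hcl : norm_closed (fun y => exists x, y = D x)).
{ apply closed_range_direct_sum; [exact HD| |].
  - intros x; assert (Hx : rng p (D x)) by (apply bounded_model_range_power; now exists x).
    apply (range_power_stable A p Hstab p), bounded_model_range_power in Hx.
    destruct Hx as [u Hu]; exists u; rewrite Hu; unfold D.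
    now rewrite <- Nat.iter_add.
  - intros x H0; apply (bounded_model_iter_injective p Hinj p); [|exact H0].
    apply bounded_model_range_power; now exists x. }
intros y Hy; apply bounded_model_range_power, Hcl; intros eps Heps.
destruct (Hy eps Heps) as (v & Hv & Hvy); apply bounded_model_range_power in Hv; eauto.
Qed.

(** The k-th power of [bounded_model] maps R(A^m) onto R(A^(m+k)) and R(A^(m+1)) into R(A^(m+k+1)).
    It thus carries vectors spanning R(A^m) modulo R(A^(m+1)) to such vectors at level m + k, where
    Kato's theorem applies to the restricted [bounded_model]. *)
Lemma range_power_closed_of_finite_codimension m :
  norm_closed (rng m) -> finite_codimension_in (rng m) (rng (S m)) ->
  forall k, norm_closed (rng (m + k)).
Proof.
intros Hm (q & e & He & Hspan); induction k as [|k IH]; [now rewrite Nat.add_0_r|].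
set (G := fun x y => rng (m + k) x /\ bounded_model x = y).
assert (HG : closed_relation G).
{ apply closed_relation_equalizer; auto using bounded_model_linear, range_power_subspace.
  (* The 0-th iterate is the identity by conversion, which presents [G] as an equalizer. *)
  exact (bounded_linear_iter bounded_model 0 bounded_model_linear). }
assert (HGr : forall y, relation_range G y <-> rng (m + S k) y).
{ intros y; rewrite Nat.add_succ_r, bounded_model_range_power; split.
  - intros (x & Hx & <-); apply bounded_model_range_power in Hx; destruct Hx as [u ->].
    now exists u.
  - intros [x ->]; exists (Nat.iter (m + k) bounded_model x); split; [|reflexivity].
    apply bounded_model_range_power; now exists x. }
set (D := Nat.iter k bounded_model).
assert (HD : bounded_linear D) by apply bounded_linear_iter, bounded_model_linear.
assert (HDrng : forall j x, rng j x -> rng (j + k) (D x)).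
{ intros j x Hx; apply bounded_model_range_power in Hx; destruct Hx as [u ->].
  apply bounded_model_range_power; exists u; unfold D; now rewrite <- Nat.iter_add, Nat.add_comm. }
assert (HDspan : forall n x, span n e x -> span n (fun i => D (e i)) (D x)).
{ intros n x [c ->]; exists c; induction n as [|n IHn].
  - rewrite !sum_n_m_zero by lia; exact (bounded_linear_zero D HD).
  - rewrite !sum_n_Sm by lia; rewrite <- IHn.
    rewrite <- (bounded_linear_scal D HD); apply (bounded_linear_plus D HD). }
assert (Hcl : norm_closed (relation_range G)).
{ apply (finite_codimension_closed (rng (m + k)) q IH G (fun i => D (e i)) HG).
  - intros z Hz; apply HGr in Hz; rewrite Nat.add_succ_r in Hz; now apply range_power_decr.
  - intros z Hz; apply bounded_model_range_power in Hz; destruct Hz as [u Hu].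
    rewrite Nat.add_comm, Nat.iter_add in Hu; fold D in Hu.
    set (w := Nat.iter m bounded_model u) in Hu.
    assert (Hw : rng m w) by (apply bounded_model_range_power; now exists u).
    destruct (Hspan w Hw) as (v & Hv & Hs); exists (D v); split.
    + apply HGr; replace (m + S k)%nat with (S m + k)%nat by lia; now apply HDrng.
    + rewrite Hu, <- (bounded_linear_minus D HD); now apply HDspan.
  - intros i Hi; apply HDrng, He, Hi.
  - intros x y; apply (range_power_subspace A (m + k)).
  - intros c x; apply (range_power_subspace A (m + k)). }
intros y Hy; apply HGr, Hcl; intros eps Heps.
destruct (Hy eps Heps) as (v & Hv & Hvy); exists v; split; [now apply HGr|exact Hvy].
Qed.

End BoundedModel.

(** * Quasi-Fredholm, Drazin invertible and B-Fredholm operators *)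

Section RealResolvents.
Context (A : linear_operator X) (Hfull : forall x, carrier A x).
Context (HA : closed_relation (graph A)).
Context (Hres : forall l, 0 < l -> exists J K, 0 <= K /\ resolvent_at A l J K).

Local Notation rng k := (range (power A k)).

(* [A] is bounded below on R(A^m), so y_l = (l - A)^-1 z stays bounded as l -> 0
   and A (- y_l) = z - l y_l converges to z. *)
Lemma range_power_stable_of_closed m :
  (forall x, rng m x -> graph A x zero -> x = zero) ->
  norm_closed (rng m) -> norm_closed (rng (S m)) ->
  forall z, rng m z -> rng (S m) z.
Proof.
intros Hinj Hm HSm z Hz.
destruct (open_mapping (fun x y => rng m x /\ graph A x y) (rng (S m)))
  as (K & HK & Hopen).
{ split.
  - split; [apply (range_power_subspace A m)|apply HA].
  - intros x y x' y' [Hx H] [Hx' H']; split; [now apply (range_power_subspace A m)|].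
    now apply (rel_plus _ HA).
  - intros k x y [Hx H]; split; [now apply (range_power_subspace A m)|].
    now apply (rel_scal _ HA).
  - intros x y H; split.
    + apply Hm; intros eps Heps; destruct (H eps Heps) as (x' & y' & [Hx' _] & Hn & _); eauto.
    + apply (rel_closed _ HA); intros eps Heps.
      destruct (H eps Heps) as (x' & y' & [_ Hx'] & Hn & Hn'); eauto. }
{ exact HSm. }
{ intros x y Hxy; apply range_power_S; now exists x. }
{ intros y Hy; now apply range_power_S in Hy. }
assert (Hbelow : forall x y, rng m x -> graph A x y -> norm x <= K * norm y).
{ intros x y Hx Hxy; destruct (Hopen y) as (x' & [Hx' Hx'y] & Hn).
  { apply range_power_S; now exists x. }
  replace x with x'; [exact Hn|].
  apply minus_zero_eq, Hinj; [now apply range_power_minus|].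
  replace (zero : X) with (minus y y) by vec; now apply (rel_minus _ HA). }
apply HSm; intros eps Heps; pose proof (norm_nonneg z) as Hnz.
set (b := 2 * (K + 1) * (norm z + 1)).
assert (Hb : 0 < b) by (unfold b; apply Rmult_lt_0_compat; lra).
(* The first bound absorbs [K * l * norm y] into [norm y / 2], whence [norm y <= 2 * K * norm z];
   the second then makes [l * norm y] smaller than [eps]. *)
set (l := Rmin (/ (2 * (K + 1))) (eps / b)).
assert (Hl : 0 < l).
{ apply Rmin_pos; [apply Rinv_0_lt_compat; lra|now apply Rdiv_lt_0_compat]. }
assert (Hl1 : l * (2 * (K + 1)) <= 1).
{ apply Rle_trans with (/ (2 * (K + 1)) * (2 * (K + 1))); [|apply Req_le; field; lra].
  apply Rmult_le_compat_r; [lra|apply Rmin_l]. }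
assert (Hl2 : l * b <= eps).
{ apply Rle_trans with (eps / b * b); [|apply Req_le; field; lra].
  apply Rmult_le_compat_r; [lra|apply Rmin_r]. }
destruct (Hres l Hl) as (J & KJ & HKJ & HJ).
set (y := J z).
assert (Hy : rng m y) by now apply (resolvent_range_power A l J KJ Hfull HA HKJ HJ).
pose proof (resolvent_right A l J KJ HJ z) as Hg; fold y in Hg.
pose proof (norm_nonneg y) as Hny.
assert (Hyz : norm y <= 2 * K * norm z).
{ pose proof (Hbelow y _ Hy Hg) as H1.
  pose proof (norm_minus_le (rscal l y) z) as H2.
  pose proof (norm_rscal_nonneg l y ltac:(lra)) as H3.
  assert (K * norm (minus (rscal l y) z) <= K * (l * norm y + norm z))
    by (apply Rmult_le_compat_l; lra).
  assert (K * (l * norm y) <= norm y / 2); [|lra].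
  replace (K * (l * norm y)) with (K * l * norm y) by ring; nra. }
exists (minus z (rscal l y)); split.
- apply range_power_S; exists (rscal (-1) y); split; [now apply range_power_rscal|].
  replace (minus z (rscal l y)) with (rscal (-1) (minus (rscal l y) z)) by vec.
  now apply (rel_rscal _ HA).
- replace (minus (minus z (rscal l y)) z) with (rscal (- l) y) by vec.
  eapply Rle_lt_trans; [apply norm_rscal_le|]; rewrite Rabs_Ropp, Rabs_pos_eq by lra.
  eapply Rlt_le_trans; [|exact Hl2]; apply Rmult_lt_compat_l; [exact Hl|].
  unfold b; nra.
Qed.

Lemma restriction_power_graph m k x y :
  power_graph (range_restriction A m) k x y -> power_graph A k x y.
Proof.
revert y; induction k as [|k IH]; simpl; intros y.
- intros [_ ->]; split; [apply Hfull|reflexivity].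
- intros (z & Hz & [_ Hzy]); exists z; auto.
Qed.

Lemma restriction_range m y : range (range_restriction A m) y <-> rng (S m) y.
Proof. symmetry; apply range_power_S. Qed.

Lemma range_power_closed_iff m :
  closed_in (carrier A) (rng m) <-> norm_closed (rng m).
Proof.
rewrite closed_in_iff by (intros; apply Hfull).
split; intros H x; [apply H, Hfull|intros _; apply H].
Qed.

(** R(A_m) is R(A^(m+1)), and a set closed relative to the closed set R(A^m) is closed in X. *)
Lemma restriction_range_closed m : norm_closed (rng m) ->
  closed_in (carrier (range_restriction A m)) (range (range_restriction A m)) ->
  norm_closed (rng (S m)).
Proof.
intros Hm H x Hx; rewrite closed_in_iff in H.
2:{ intros y Hy; now apply range_power_decr, restriction_range. }
apply restriction_range, H.
- apply Hm; intros eps Heps; destruct (Hx eps Heps) as (y & Hy & Hn).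
  exists y; split; [now apply range_power_decr|exact Hn].
- intros eps Heps; destruct (Hx eps Heps) as (y & Hy & Hn).
  exists y; split; [now apply restriction_range|exact Hn].
Qed.

Lemma restriction_bijective m :
  norm_closed (rng m) -> (forall x, rng m x -> graph A x zero -> x = zero) ->
  (forall y, rng m y -> rng (S m) y) -> quasi_Fredholm A /\ B_Fredholm A.
Proof.
intros Hm Hinj Hsurj.
assert (Hcl : closed_in (carrier (range_restriction A m)) (range (range_restriction A m))).
{ intros x Hx _; apply restriction_range, Hsurj, Hx. }
assert (Hker : forall x, kernel (range_restriction A m) x -> x = zero).
{ intros x [Hx Hx0]; now apply Hinj. }
split; exists m; (split; [now apply range_power_closed_iff|]).
- split; [exact Hcl|]; intros x Hx k; apply Hker in Hx; subst x.
  exists zero; apply (power_graph_zero (range_restriction A m)).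
(* The empty family spans both the kernel and a complement of the range. *)
- split; [|split; [exact Hcl|]]; exists O, (fun _ => zero).
  + split; [intros i Hi; lia|]; intros x Hx; apply span_0; now apply Hker.
  + split; [intros i Hi; lia|]; intros x Hx.
    exists x; split; [apply restriction_range, Hsurj, Hx|apply span_0]; vec.
Qed.

Context (n : nat) (Hdisj : forall x, rng n x -> graph A x zero -> x = zero).

Lemma kernel_range_disjoint_add k x : rng (n + k) x -> graph A x zero -> x = zero.
Proof. intros Hx; apply Hdisj; now apply (range_power_add_decr A n k). Qed.

(** The infimum of a nonempty set of naturals lies between 0 and a member; that of the empty set is
    [p_infty]. *)
Lemma Glb_Rbar_nat_finite (P : nat -> Prop) :
  is_finite (Glb_Rbar (fun r => exists m : nat, r = INR m /\ P m)) <-> exists m, P m.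
Proof.
set (E := fun r => exists m : nat, r = INR m /\ P m).
pose proof (Glb_Rbar_correct E) as [Hlb Hglb]; split.
- intros Hf; apply NNPP; intros Hno.
  assert (Hp : Rbar_le p_infty (Glb_Rbar E)).
  { apply Hglb; intros r (m & _ & Hm); exfalso; eauto. }
  rewrite <- Hf in Hp; exact Hp.
- intros [m Hm].
  specialize (Hlb (INR m) (ex_intro _ m (conj eq_refl Hm))).
  assert (H0 : Rbar_le 0 (Glb_Rbar E)).
  { apply Hglb; intros r (k & -> & _); apply pos_INR. }
  destruct (Glb_Rbar E); [reflexivity|destruct Hlb|destruct H0].
Qed.

Lemma Drazin_invertible_iff :
  Drazin_invertible A <-> exists d, forall y, rng d y -> rng (S d) y.
Proof.
unfold Drazin_invertible, ascent, descent; rewrite !Glb_Rbar_nat_finite; split.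
- intros [_ [d Hd]]; exists d; intros y; apply Hd.
- intros [d Hd]; split.
  (* If A^(n+1) x = 0, then A^n x lies in both N(A) and R(A^n). *)
  + exists n; intros x; split; intros H.
    * exists zero; split; [exact H|apply graph_zero].
    * destruct H as (z & Hxz & Hz0).
      rewrite (Hdisj z) in Hxz; [exact Hxz|now exists x|exact Hz0].
  + exists d; intros y; split; [apply Hd|apply range_power_decr].
Qed.

Lemma quasi_Fredholm_Drazin : quasi_Fredholm A -> Drazin_invertible A.
Proof.
intros (m & Hm & Hcl & Hker); apply Drazin_invertible_iff; exists m.
apply range_power_closed_iff in Hm.
apply range_power_stable_of_closed; [|exact Hm|now apply restriction_range_closed].
(* Kernel vectors of A_m lie in the range of its n-th power, which is part of R(A^n). *)
intros x Hx Hx0; apply Hdisj; [|exact Hx0].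
destruct (Hker x (conj Hx Hx0) n) as [u Hu]; exists u; now apply restriction_power_graph in Hu.
Qed.

Lemma Drazin_Fredholm : Drazin_invertible A -> quasi_Fredholm A /\ B_Fredholm A.
Proof.
intros HD; apply Drazin_invertible_iff in HD; destruct HD as [d Hd].
(* Level [n + d] is beyond [n], where [A] is injective, and beyond [d], where the ranges are
   stable. *)
assert (Hstab : forall y, rng (n + d) y -> rng (S (n + d)) y).
{ intros y Hy; rewrite Nat.add_comm in *; rewrite <- Nat.add_succ_r.
  apply (range_power_stable A d Hd); now apply range_power_add_decr in Hy. }
destruct (Hres 1 Rlt_0_1) as (J & K & HK & HJ).
apply (restriction_bijective (n + d)); [|apply kernel_range_disjoint_add|exact Hstab].
apply (range_power_closed_of_stable A 1 J K Hfull HA Rlt_0_1 HK HJ);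
  [apply kernel_range_disjoint_add|exact Hstab].
Qed.

Lemma B_Fredholm_Drazin : B_Fredholm A -> Drazin_invertible A.
Proof.
intros (m & Hm & _ & Hcl & q & e & He & Hspan).
apply range_power_closed_iff in Hm.
assert (Hcodim : finite_codimension_in (rng m) (rng (S m))).
{ exists q, e; split; [exact He|]; intros x Hx; destruct (Hspan x Hx) as (v & Hv & Hs).
  exists v; split; [now apply restriction_range|exact Hs]. }
destruct (Hres 1 Rlt_0_1) as (J & K & HK & HJ).
pose proof (range_power_closed_of_finite_codimension A 1 J K Hfull HA Rlt_0_1 HK HJ m Hm Hcodim)
  as Hclosed.
(* Adding [n] secures injectivity; the codimension argument supplies closedness at levels m + n and
   m + n + 1. *)
apply Drazin_invertible_iff; exists (m + n)%nat.
apply range_power_stable_of_closed.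
- rewrite Nat.add_comm; apply kernel_range_disjoint_add.
- apply Hclosed.
- rewrite <- Nat.add_succ_r; apply Hclosed.
Qed.

End RealResolvents.

(** * The growth hypothesis in terms of the operator norm *)

Lemma operator_norm_bound (f : X -> X) : is_linear f ->
  forall x, norm (f x) <= operator_norm f * norm x.
Proof.
intros Hf x; set (E := fun r => exists x, norm x <= 1 /\ r = norm (f x)).
change (norm (f x) <= real (Lub_Rbar E) * norm x).
destruct (linear_norm _ Hf) as (M & HM & HfM).
pose proof (Lub_Rbar_correct E) as [Hub Hlub].
(* The supremum lies between [norm (f zero)] and [M], so it is finite and [real] returns its true
   value. *)
assert (HEM : Rbar_le (Lub_Rbar E) M).
{ apply Hlub; intros r (u & Hu & ->).
  assert (H1 : norm (f u) <= M * norm u) by apply HfM.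
  simpl; pose proof (norm_nonneg u); nra. }
assert (HE0 : Rbar_le (norm (f zero)) (Lub_Rbar E)).
{ apply Hub; exists zero; split; [rewrite norm_zero_eq; lra|reflexivity]. }
destruct (Lub_Rbar E) as [L| |]; [|destruct HEM|destruct HE0].
change (norm (f x) <= L * norm x).
destruct (Req_dec (norm x) 0) as [H0|Hn].
{ assert (H1 : norm (f x) <= M * norm x) by apply HfM; rewrite H0, Rmult_0_r in *; exact H1. }
assert (Hx : 0 < norm x) by (pose proof (norm_nonneg x); lra).
assert (Hi : 0 < / norm x) by now apply Rinv_0_lt_compat.
assert (HL : norm (f (rscal (/ norm x) x)) <= L).
{ apply (Hub (norm (f (rscal (/ norm x) x)))); exists (rscal (/ norm x) x); split; [|reflexivity].
  eapply Rle_trans; [apply norm_rscal_nonneg; lra|]; apply Req_le; field; lra. }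
assert (Hfs : f (rscal (/ norm x) x) = rscal (/ norm x) (f x))
  by exact (linear_scal _ Hf (RtoC (/ norm x) : C_AbsRing) x).
rewrite Hfs in HL.
replace (f x) with (rscal (norm x) (rscal (/ norm x) (f x))) at 1 by (vec_field; lra).
eapply Rle_trans; [apply norm_rscal_nonneg; lra|].
rewrite (Rmult_comm L); apply Rmult_le_compat_l; lra.
Qed.

Lemma growth_of_limit (T : C0_semigroup X) (n : nat) :
  is_lim (fun t : R => 1 / t ^ n * operator_norm (T t)) p_infty 0 -> growth_little_o n T.
Proof.
intros H eps Heps.
apply is_lim_spec in H; destruct (H (mkposreal eps Heps)) as [M HM]; simpl in HM.
(* The limit speaks only of [t > M], hence [M + 1]; the maximum with 1 ensures [t ^ n > 0]. *)
exists (Rmax 1 (M + 1)); pose proof (Rmax_l 1 (M + 1)); pose proof (Rmax_r 1 (M + 1)).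
split; [lra|]; intros t Ht x; specialize (HM t ltac:(lra)).
eapply Rle_trans; [apply operator_norm_bound, semigroup_linear; lra|].
apply Rmult_le_compat_r; [apply norm_nonneg|].
assert (Hp : 0 < t ^ n) by (apply pow_lt; lra).
rewrite Rminus_0_r in HM; pose proof (Rle_abs (1 / t ^ n * operator_norm (T t))).
apply (Rmult_le_reg_l (/ t ^ n)); [now apply Rinv_0_lt_compat|].
replace (/ t ^ n * (eps * t ^ n)) with eps by (field; lra).
unfold Rdiv in *; lra.
Qed.

End GeneratorTheory.

Theorem theorem2p3 (X : CompleteNormedModule C_AbsRing) (T : C0_semigroup X)
  (n : nat)
  (hT : is_lim (fun t : R => 1 / t ^ n * operator_norm (T t)) p_infty 0) :
  (quasi_Fredholm (generator T) <-> Drazin_invertible (generator T)) /\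
  (Drazin_invertible (generator T) <-> B_Fredholm (generator T)).
Proof.
apply growth_of_limit in hT.
assert (Hfull : forall x, carrier (generator T) x) by (intros x; exact I).
pose proof (generator_closed T) as Hcl.
pose proof (fun l => generator_resolvent n T l hT) as Hres.
assert (Hdisj : forall x, range (power (generator T) n) x ->
   graph (generator T) x zero -> x = zero).
{ intros x [u Hu]; exact (kernel_range_disjoint n T u x hT Hu). }
pose proof (Drazin_Fredholm (generator T) Hfull Hcl Hres n Hdisj) as HD.
pose proof (quasi_Fredholm_Drazin (generator T) Hfull Hcl Hres n Hdisj).
pose proof (B_Fredholm_Drazin (generator T) Hfull Hcl Hres n Hdisj).
tauto.
Qed.
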